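(* Let $m, n \in \mathbb{N}$, and let $A \in \mathbb{C}^{n \times n}$ be a diagonalizable matrix with eigendecomposition $A = V \Lambda V^{-1}$ ($\Lambda$ diagonal), where the columns of $V$ have Euclidean norm one. Let $\boldsymbol{b}\in\mathbb{C}^n$ be nonzero and $\boldsymbol{\alpha}=V^{-1}\boldsymbol{b}$. Then $$d_H\big(W(H_{6m+1}),W(A) \big) \le \bigg(\frac{6\kappa^2(V) }{m}\ln \bigg( \frac{e\, m\, \|\boldsymbol{\alpha}\|^2_2 }{6 \min_{j \in [n]} | \boldsymbol{\alpha}_j |^2}\bigg) +4\kappa(V) (\kappa(V)-1)\bigg)\, \mathrm{diam}(\mathrm{conv}(\Lambda(A))).$$ In particular, if $\boldsymbol{b} \sim \mathrm{Unif}(\mathbb{S}^{n-1})$, then for every $\alpha>0$ $$\mathbb{P}\bigg[ \frac{d_{H}\big(W(H_{6m+1}),W(A) \big)}{\mathrm{diam}(\mathrm{conv}(\Lambda(A)))} \le \frac{6\kappa^2(V) }{m}\ln \big( n^{2+\alpha} \kappa^2(V)\big) +4\kappa(V) (\kappa(V)-1) \bigg] \ge 1 - \frac{5m}{4n^{\alpha}}.$$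
   Context: $\mathbb{N}$ denotes the positive integers and $[n]=\{1,\dots,n\}$. The numerical range of a square matrix $M\in\mathbb{C}^{k\times k}$ is $W(M)=\{\boldsymbol{x}^*M\boldsymbol{x}/\boldsymbol{x}^*\boldsymbol{x} : \boldsymbol{x}\in\mathbb{C}^k\setminus\{0\}\}$. For $A\in\mathbb{C}^{n\times n}$, nonzero $\boldsymbol{b}\in\mathbb{C}^n$ and $k\in\mathbb{N}$, the Krylov subspace is $\mathcal{K}_k(A,\boldsymbol{b})=\mathrm{span}\{\boldsymbol{b},A\boldsymbol{b},\ldots,A^{k-1}\boldsymbol{b}\}$, and $H_k=Q^*AQ$, where the columns of $Q$ form an orthonormal basis of $\mathcal{K}_k(A,\boldsymbol{b})$ (if $\dim\mathcal{K}_k(A,\boldsymbol{b})<k$, then $H_k$ has size $\dim\mathcal{K}_k(A,\boldsymbol{b})$); thus $W(H_k)=\{\boldsymbol{x}^*A\boldsymbol{x}/\boldsymbol{x}^*\boldsymbol{x} : \boldsymbol{x}\in\mathcal{K}_k(A,\boldsymbol{b})\setminus\{0\}\}$. $\Lambda(A)$ is the spectrum of $A$, $\mathrm{conv}$ is the convex hull, $\mathrm{diam}$ is the diameter, and $\kappa(V)=\|V\|_2\|V^{-1}\|_2$ is the condition number in the spectral norm. $d_H$ is the Hausdorff distance between subsets of $\mathbb{C}$. $\mathbb{S}^{n-1}$ is the complex unit sphere in $\mathbb{C}^n$, with uniform probability measure $\mathrm{Unif}(\mathbb{S}^{n-1})$. The right-hand side of the first inequality is read as vacuous ($+\infty$)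 when $\min_{j}|\boldsymbol{\alpha}_j|=0$, and an inequality of the form $x/\mathrm{diam}(\cdot)\le y$ is read as $x\le y\,\mathrm{diam}(\cdot)$.
   Formalization: In the first inequality the coefficient of diam(conv(Λ(A))) is replaced by its positive part; as printed it can be negative and the bound false, e.g. m=1, n=2, A=diag(0,1), V=I, b=(1,1), where d_H=0 but the right side is 6 ln(e/3)<0. *)

(* Defs.v *)
From HB Require Import structures.
From mathcomp Require Import all_boot all_order all_algebra.
From mathcomp Require Import all_classical all_reals all_analysis.
From mathcomp Require Export complex.

Set Implicit Arguments.
Unset Strict Implicit.
Unset Printing Implicit Defensive.

Import Order.TTheory GRing.Theory Num.Theory.
Import numFieldNormedType.Exports.
Import ComplexField.Normc.

Local Open Scope classical_set_scope.
Local Open Scope ring_scope.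
Local Open Scope complex_scope.
Local Open Scope sesquilinear_scope.

Section LinearAlgebra.
Variable R : realType.
Local Notation C := R[i].

Definition l2norm n (x : 'cV[C]_n) : R :=
  Num.sqrt (\sum_(i < n) normc (x i 0) ^+ 2).

Definition spectral_norm n (M : 'M[C]_n) : R :=
  sup [set l2norm (M *m x) | x in [set x : 'cV[C]_n | l2norm x = 1]].

Definition cond n (V : 'M[C]_n) : R :=
  spectral_norm V * spectral_norm (invmx V).

(* min_j |a_j|^2; for 0 < n this is an infimum over a finite nonempty set. *)
Definition min_sqr n (a : 'cV[C]_n) : R :=
  inf [set normc (a j 0) ^+ 2 | j in [set: 'I_n]].

Definition numrange k (M : 'M[C]_k) : set C :=
  [set (x^t* *m M *m x) 0 0 / (x^t* *m x) 0 0
  | x in [set x : 'cV[C]_k | x != 0]].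

Definition spectrum n (A : 'M[C]_n) : set C := [set z | eigenvalue A z].

Definition krylov n (A : 'M[C]_n) (b : 'cV[C]_n) (k : nat) : {vspace 'cV[C]_n} :=
  <<mkseq (fun i => iter i (mulmx A) b) k>>%VS.

Definition orthonormal_basis n (K : {vspace 'cV[C]_n}) r (Q : 'M[C]_(n, r)) :=
  Q^t* *m Q = 1%:M /\ basis_of K [seq col j Q | j : 'I_r].

Definition compression n r (A : 'M[C]_n) (Q : 'M[C]_(n, r)) : 'M[C]_r :=
  Q^t* *m A *m Q.

End LinearAlgebra.

Section PlaneSets.
Variable R : realType.
Local Notation C := R[i].
Implicit Types X Y : set C.

Definition convex_hull X : set C :=
  [set z | exists k (t : 'I_k -> R) (x : 'I_k -> C),
    [/\ forall i, 0 <= t i, \sum_(i < k) t i = 1, forall i, X (x i)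
      & z = \sum_(i < k) (t i)%:C * x i]].

Definition diam X : \bar R :=
  ereal_sup [set d | exists x y, [/\ X x, X y & d = (normc (x - y))%:E]].

Definition dist_to X (z : C) : \bar R :=
  ereal_inf [set (normc (z - x))%:E | x in X].

Definition hausdorff X Y : \bar R :=
  maxe (ereal_sup [set dist_to Y x | x in X])
       (ereal_sup [set dist_to X y | y in Y]).

End PlaneSets.

(* C^n with its Borel sigma-algebra; the alias ^o is what gives R[i] its norm
   topology, and 'cV[R[i]^o]_n the product topology. *)
Definition borelC (R : realType) n :=
  g_sigma_algebraType (@open 'cV[R[i]^o]_n).

(* Unif(S^(n-1)) is the unique Borel probability measure that is carried by
   the unit sphere of C^n and invariant under the unitary group, which acts
   transitively on that sphere. *)
Definition uniform_sphere (R : realType) n (mu : probability (borelC R n) R) :=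
  mu [set x : 'cV[R[i]]_n | l2norm x = 1] = 1%E /\
  forall U : 'M[R[i]]_n, U \is unitarymx ->
    forall B : set (borelC R n), measurable B ->
      mu [set x : 'cV[R[i]]_n | B (U *m x)] = mu B.

(* Main.v *)
(* Write vectors as x = V c and let w(c) be the mean of the eigenvalues with
   weights |c_j|^2.  Splitting Lambda c into its component along c and the
   orthogonal one shows that the Rayleigh quotient of A at V c is within
   (kappa^2 - 1) / 2 times the diameter of w(c), so it suffices to treat w, that
   is, the diagonal matrix, on the subspace of all c_j = p(lambda_j) alpha_j.
   There the values w(c) form a convex set (Toeplitz-Hausdorff), so approximation
   may be checked direction by direction: if lambda_i is extremal in the direction
   u and z_j in the unit half disk is the rescaled conj(u) (lambda_i - lambda_j),
   the polynomial (1 - z/2 + z^2/4)^(3m) is 1 at lambda_i and at most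
   exp(- m Re z_j / 2) in modulus at lambda_j, which yields the error
   ln(|alpha|^2 / min_j |alpha_j|^2) / m.  This is better than required unless
   n <= 2, where the Krylov space is the whole space or A is scalar.

   The resulting bound is so strong that a crude anti-concentration estimate is
   enough for random b: rotating one coordinate plane moves a thin slab of the
   sphere through many disjoint positions of equal probability. *)

Require Import Defs.
From HB Require Import structures.
From mathcomp Require Import all_boot all_order all_algebra.
From mathcomp Require Import all_classical all_reals all_analysis.
From mathcomp Require Import complex.
From mathcomp Require Import zify ring lra.

Set Implicit Arguments.
Unset Strict Implicit.
Unset Printing Implicit Defensive.

Import Order.TTheory GRing.Theory Num.Theory.
Import numFieldNormedType.Exports.
Import ComplexField.Normc.

Local Open Scope classical_set_scope.
Local Open Scope ring_scope.
Local Open Scope complex_scope.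
Local Open Scope sesquilinear_scope.

Local Notation Re := (@complex.Re _).
Local Notation Im := (@complex.Im _).

(** * Complex numbers through their real and imaginary parts *)

Section ComplexNumbers.
Variable R : realType.
Implicit Types (x y z w : R[i]).

Lemma Re_D z w : Re (z + w) = Re z + Re w. Proof. by case: z w => ? ? []. Qed.

Lemma Im_D z w : Im (z + w) = Im z + Im w. Proof. by case: z w => ? ? []. Qed.

Lemma Re_N z : Re (- z) = - Re z. Proof. by case: z. Qed.

Lemma Im_N z : Im (- z) = - Im z. Proof. by case: z. Qed.

Lemma Re_M z w : Re (z * w) = Re z * Re w - Im z * Im w.
Proof. by case: z w => ? ? []. Qed.

Lemma Im_M z w : Im (z * w) = Re z * Im w + Im z * Re w.
Proof. by case: z w => ? ? []. Qed.

Lemma Re_J z : Re (conjc z) = Re z. Proof. by case: z. Qed.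

Lemma Im_J z : Im (conjc z) = - Im z. Proof. by case: z. Qed.

Definition ReImE := (Re_D, Im_D, Re_N, Im_N, Re_M, Im_M, Re_J, Im_J).

Lemma Re_sum (I : Type) (r : seq I) (P : pred I) (F : I -> R[i]) :
  Re (\sum_(i <- r | P i) F i) = \sum_(i <- r | P i) Re (F i).
Proof. by apply: (big_morph _ Re_D). Qed.

Lemma complexP z w : Re z = Re w -> Im z = Im w -> z = w.
Proof. by case: z w => ? ? [? ?] /= -> ->. Qed.

Lemma normc_ge0 z : 0 <= normc z.
Proof. by case: z => a b; apply: sqrtr_ge0. Qed.

Lemma normc_sqr z : normc z ^+ 2 = Re z ^+ 2 + Im z ^+ 2.
Proof. by case: z => a b /=; rewrite sqr_sqrtr// addr_ge0 ?sqr_ge0. Qed.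

Lemma normcJ z : normc (conjc z) = normc z.
Proof. by case: z => a b /=; rewrite sqrrN. Qed.

Lemma normc_real (a : R) : normc a%:C = `|a|.
Proof. by rewrite /normc /= expr0n addr0 sqrtr_sqr. Qed.

Lemma normcX z k : normc (z ^+ k) = normc z ^+ k.
Proof.
by elim: k => [|k IH]; rewrite ?expr0 ?normc1// !exprS normcM IH.
Qed.

Lemma normc_eq0 z : (normc z == 0) = (z == 0).
Proof. by apply/eqP/eqP => [/eq0_normc//|->]; rewrite normc0. Qed.

Lemma normc_gt0 z : (0 < normc z) = (z != 0).
Proof. by rewrite lt_def normc_eq0 normc_ge0 andbT. Qed.

Lemma normr_Re_le z : `|Re z| <= normc z.
Proof.
rewrite -ler_sqr ?nnegrE ?normc_ge0// normc_sqr real_normK ?num_real//.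
by rewrite lerDl sqr_ge0.
Qed.

Lemma normr_Im_le z : `|Im z| <= normc z.
Proof.
rewrite -ler_sqr ?nnegrE ?normc_ge0// normc_sqr real_normK ?num_real//.
by rewrite lerDr sqr_ge0.
Qed.

Lemma normc_le_ReIm z : normc z <= `|Re z| + `|Im z|.
Proof.
rewrite -ler_sqr ?nnegrE ?normc_ge0 ?addr_ge0// normc_sqr sqrrD.
rewrite !real_normK ?num_real// -addrA lerD2l lerDr mulrn_wge0// mulr_ge0//.
Qed.

Lemma mulJc z : conjc z * z = (normc z ^+ 2)%:C.
Proof. by rewrite normc_sqr; case: z => a b; apply: complexP => /=; ring. Qed.

Lemma le_normc_sum (I : Type) (r : seq I) (P : pred I) (F : I -> R[i]) :
  normc (\sum_(i <- r | P i) F i) <= \sum_(i <- r | P i) normc (F i).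
Proof.
elim/big_ind2: _ => [|x1 x2 y1 y2 h1 h2|//]; first by rewrite normc0.
exact: le_trans (le_normcD _ _) (lerD h1 h2).
Qed.

End ComplexNumbers.

(** * The Hermitian inner product and the Euclidean norm *)

Section InnerProduct.
Variable R : realType.
Variable n : nat.
Local Notation C := R[i].
Implicit Types (x y z : 'cV[C]_n) (a : C).

Definition dotv x y : C := (x^t* *m y) 0 0.

Lemma dotvE x y : dotv x y = \sum_i conjc (x i 0) * y i 0.
Proof. by rewrite /dotv mxE; apply: eq_bigr => i _; rewrite !mxE. Qed.

Lemma dotvDr x y z : dotv x (y + z) = dotv x y + dotv x z.
Proof. by rewrite /dotv mulmxDr mxE. Qed.

Lemma dotvZr x y a : dotv x (a *: y) = a * dotv x y.
Proof. by rewrite /dotv -scalemxAr mxE. Qed.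

Lemma dotvC x y : dotv y x = conjc (dotv x y).
Proof.
rewrite !dotvE rmorph_sum; apply: eq_bigr => i _.
by rewrite rmorphM /= conjcK mulrC.
Qed.

Lemma dotvDl x y z : dotv (x + y) z = dotv x z + dotv y z.
Proof. by rewrite dotvC dotvDr rmorphD /= -!dotvC. Qed.

Lemma dotvZl x y a : dotv (a *: x) y = conjc a * dotv x y.
Proof. by rewrite dotvC dotvZr rmorphM /= -dotvC. Qed.

Lemma dotvNr x y : dotv x (- y) = - dotv x y.
Proof. by rewrite -scaleN1r dotvZr mulN1r. Qed.

Lemma dotvBr x y z : dotv x (y - z) = dotv x y - dotv x z.
Proof. by rewrite dotvDr dotvNr. Qed.

Lemma l2norm_ge0 x : 0 <= l2norm x.
Proof. exact: sqrtr_ge0. Qed.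

Lemma l2norm_sqr x : l2norm x ^+ 2 = \sum_i normc (x i 0) ^+ 2.
Proof. by rewrite sqr_sqrtr// sumr_ge0// => i _; apply: sqr_ge0. Qed.

Lemma dotvv x : dotv x x = (l2norm x ^+ 2)%:C.
Proof.
rewrite l2norm_sqr dotvE rmorph_sum; apply: eq_bigr => i _; exact: mulJc.
Qed.

Lemma l2norm0 : l2norm (0 : 'cV[C]_n) = 0.
Proof.
by rewrite /l2norm big1 ?sqrtr0// => i _; rewrite mxE normc0 expr0n.
Qed.

Lemma normc_le_l2norm x i : normc (x i 0) <= l2norm x.
Proof.
rewrite -ler_sqr ?nnegrE ?normc_ge0 ?l2norm_ge0// l2norm_sqr (bigD1 i)//=.
by rewrite lerDl sumr_ge0// => j _; apply: sqr_ge0.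
Qed.

Lemma l2norm_gt0 x : (0 < l2norm x) = (x != 0).
Proof.
apply/idP/idP => [|x0]; first by apply: contraTneq => ->; rewrite l2norm0 ltxx.
rewrite lt_def l2norm_ge0 andbT; apply: contra x0 => /eqP h.
apply/eqP/matrixP => i j; rewrite ord1 mxE; apply/eqP; rewrite -normc_eq0.
by rewrite eq_le normc_ge0 andbT -h normc_le_l2norm.
Qed.

Lemma l2normZ x a : l2norm (a *: x) = normc a * l2norm x.
Proof.
apply/eqP; rewrite -(@eqrXn2 _ 2) ?mulr_ge0 ?normc_ge0 ?l2norm_ge0//.
rewrite exprMn !l2norm_sqr mulr_sumr; apply/eqP/eq_bigr => i _.
by rewrite mxE normcM exprMn.
Qed.

Lemma l2norm_sqrD x y :
  l2norm (x + y) ^+ 2 = l2norm x ^+ 2 + l2norm y ^+ 2 + 2 * Re (dotv x y).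
Proof.
apply: (@complexI R); rewrite -dotvv !(dotvDl, dotvDr) !dotvv (dotvC x y).
by case: (dotv x y) => a b; apply: complexP => /=; ring.
Qed.

Lemma dotv_delta x i : dotv (delta_mx i 0) x = x i 0.
Proof.
rewrite dotvE (bigD1 i)//= big1 ?addr0 => [|j ji]; rewrite mxE.
  by rewrite !eqxx conjc_nat mul1r.
by rewrite (negbTE ji) conjc_nat mul0r.
Qed.

End InnerProduct.

Lemma dotv_mulmx (R : realType) (n k : nat) (M : 'M[R[i]]_(n, k))
    (x : 'cV[R[i]]_k) (y : 'cV[R[i]]_n) :
  dotv (M *m x) y = dotv x (M^t* *m y).
Proof. by rewrite /dotv trmx_mul map_mxM mulmxA. Qed.

(** * Rayleigh quotients and convexity of the numerical range *)

Section Rayleigh.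
Variable R : realType.
Variable n : nat.
Local Notation C := R[i].
Implicit Types (x y z : 'cV[C]_n) (M : 'M[C]_n).

Definition rayleigh M x : C := dotv x (M *m x) / dotv x x.

Lemma dotvv_neq0 x : x != 0 -> dotv x x != 0.
Proof.
move=> x0; rewrite dotvv; apply/eqP => /(congr1 (@complex.Re R)) /= /eqP.
by rewrite expf_eq0 /= gt_eqF// l2norm_gt0.
Qed.

Lemma rayleighZ M x (k : C) : k != 0 -> rayleigh M (k *: x) = rayleigh M x.
Proof.
move=> k0; rewrite /rayleigh -scalemxAr !dotvZl !dotvZr.
have k'0 : conjc k != 0 by rewrite conjc_eq0.
by rewrite !mulrA invfM mulrACA divff ?mul1r// mulf_neq0.
Qed.

(** The signs of [a] and [c] make the discriminant [b ^+ 2 + 4 * a * c] nonnegative. *)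
Lemma quadratic_root (a b c : R) : 0 < a -> 0 <= c ->
  exists s, a * s ^+ 2 + b * s = c.
Proof.
move=> a0 c0; exists ((Num.sqrt (b ^+ 2 + 4 * a * c) - b) / (2 * a)).
have := @sqr_sqrtr R (b ^+ 2 + 4 * a * c).
rewrite addr_ge0 ?sqr_ge0 ?mulr_ge0 ?(ltW a0)// => /(_ isT).
set r := Num.sqrt _ => hr.
have -> : c = (r ^+ 2 - b ^+ 2) / (4 * a) by rewrite hr; field; rewrite gt_eqF.
by field; rewrite gt_eqF.
Qed.

(** The imaginary part equals that of [g * (p - conjc q)], so the conjugate of the second factor
    serves as [g] unless that factor vanishes. *)
Lemma phase_cross (p q : C) :
  exists2 g : C, g != 0 & Im (g * p + conjc g * q) = 0.
Proof.
have [e|e] := eqVneq (p - conjc q) 0.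
  exists 1; first exact: oner_neq0.
  move: (congr1 (@complex.Im R) e); rewrite !ReImE /= => h.
  by rewrite !(mul1r, mul0r, oppr0, addr0); lra.
exists (conjc (p - conjc q)); first by rewrite conjc_eq0.
by case: p q {e} => [a b] [c d] /=; ring.
Qed.

(** The growth of a sesquilinear form from [x] to [x + s g y], with cross terms [p], [q] and value
    [Y] at [y]. It serves both the normalized form and the squared norm. *)
Lemma hermitian_expand (g p q : C) (s Y : R) : Im (g * p + conjc g * q) = 0 ->
  s%:C * g * p + conjc (s%:C * g) * (q + s%:C * g * Y%:C)
  = (s * Re (g * p + conjc g * q) + s ^+ 2 * (normc g ^+ 2 * Y))%:C.
Proof.
rewrite normc_sqr; case: g p q => [a b] [c d] [e f] /= h.
apply: complexP => /=; first by ring.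
by apply: etrans (etrans (congr1 ( *%R s) h) (mulr0 s)); ring.
Qed.

(* Toeplitz-Hausdorff: rotating y by a phase makes the cross terms of the
   normalized form real, and the prescribed value is the root of a quadratic. *)
Lemma rayleigh_convex M x y (t : R) : x != 0 -> y != 0 -> 0 <= t <= 1 ->
  exists a b : C, a *: x + b *: y != 0 /\
    rayleigh M (a *: x + b *: y)
    = (1 - t)%:C * rayleigh M x + t%:C * rayleigh M y.
Proof.
move=> x0 y0 /andP[t0 t1].
have x_case s : t = 0 \/ rayleigh M x = rayleigh M y -> s = 1 - t ->
    s%:C * rayleigh M x + t%:C * rayleigh M y = rayleigh M x.
  move=> h ->; have [->|<-] := h; first by rewrite subr0 mul1r mul0r addr0.
  by rewrite -mulrDl -rmorphD /= subrK mul1r.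
have [w01|w01] := eqVneq (rayleigh M x) (rayleigh M y).
  by exists 1, 0; rewrite scale1r scale0r addr0 x_case//; right.
have [t1'|t1'] := eqVneq t 1.
  exists 0, 1; rewrite scale1r scale0r add0r t1' subrr.
  by rewrite mul0r add0r mul1r.
have lt1 : 0 < 1 - t by rewrite subr_gt0 lt_neqAle t1' t1.
set w0 := rayleigh M x; set w1 := rayleigh M y; set dw := w1 - w0.
have dw0 : dw != 0 by rewrite subr_eq0 eq_sym.
(* The form of [M] shifted and scaled to vanish at [x] and to agree with the squared norm at [y]:
   the claim at [z] becomes [B z z = t%:C * dotv z z]. *)
pose B u v := (dotv u (M *m v) - w0 * dotv u v) / dw.
have BDl u v z : B (u + v) z = B u z + B v z.
  by rewrite /B !dotvDl mulrDr opprD addrACA mulrDl.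
have BDr u v z : B z (u + v) = B z u + B z v.
  by rewrite /B mulmxDr !dotvDr mulrDr opprD addrACA mulrDl.
have BZl u v k : B (k *: u) v = conjc k * B u v.
  by rewrite /B !dotvZl mulrCA -mulrBr -mulrA.
have BZr u v k : B u (k *: v) = k * B u v.
  by rewrite /B -scalemxAr !dotvZr mulrCA -mulrBr -mulrA.
have Bxx : B x x = 0.
  rewrite /B -[dotv x (M *m x)](divfK (dotvv_neq0 x0)) -/(rayleigh M x).
  by rewrite subrr mul0r.
have Byy : B y y = dotv y y.
  rewrite /B -[dotv y (M *m y)](divfK (dotvv_neq0 y0)) -/(rayleigh M y).
  by rewrite -mulrBl mulrAC divff ?mul1r.
have [g g0 ImgW] := phase_cross (B x y) (B y x).
pose be := Re (g * B x y + conjc g * B y x).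
pose ga := 2 * Re (g * dotv x y).
pose X := l2norm x ^+ 2; pose G := normc g ^+ 2 * l2norm y ^+ 2.
have X0 : 0 < X by rewrite exprn_gt0 ?l2norm_gt0.
have G0 : 0 < G by rewrite mulr_gt0 ?exprn_gt0 ?l2norm_gt0 ?normc_gt0.
(* At [x + s g y] the form is [s * be + s ^+ 2 * G] and the squared norm is
   [X + s * ga + s ^+ 2 * G]; asking for the ratio [t] gives this quadratic in [s]. *)
have [s hs] := @quadratic_root ((1 - t) * G) (be - t * ga) (t * X)
  (mulr_gt0 lt1 G0) (mulr_ge0 t0 (ltW X0)).
exists 1, (s%:C * g); rewrite scale1r; set z := x + _.
have Bzz : B z z = (s * be + s ^+ 2 * G)%:C.
  rewrite /z !(BDl, BDr, BZl, BZr) Bxx Byy add0r dotvv.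
  exact: hermitian_expand.
have Nzz : dotv z z = (X + s * ga + s ^+ 2 * G)%:C.
  rewrite /z !(dotvDl, dotvDr, dotvZl, dotvZr) !dotvv (dotvC x y) -/X.
  rewrite -!addrA rmorphD; congr (_ + _); rewrite -mulrDr hermitian_expand.
    by rewrite /ga; congr (_%:C); rewrite !ReImE; congr (_ + _); ring.
  by rewrite !ReImE; ring.
have BN : B z z = t%:C * dotv z z.
  by rewrite Bzz Nzz -rmorphM /=; congr (_%:C); lra.
(* If [z] vanished, [x] would be a multiple of [y] and the two Rayleigh quotients would agree. *)
have z0 : z != 0.
  apply: contra_neq w01 => /eqP; rewrite addr_eq0 -scaleNr => /eqP xE.
  rewrite xE rayleighZ//; apply: contra_neq x0 => k0.
  by rewrite xE k0 scale0r.
split=> //; have := BN; rewrite /B => /(canRL (mulfVK dw0)) h.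
rewrite {1}/rayleigh -[dotv z (M *m z)](subrK (w0 * dotv z z)) h.
rewrite rmorphB /= /dw; field; exact: dotvv_neq0.
Qed.

End Rayleigh.

(** * Distance to a convex set, tested direction by direction *)

Section NearestPoint.
Variable R : realType.
Local Notation C := R[i].

Lemma normc_sqrB_scale (v d : C) (t : R) :
  normc (v - t%:C * d) ^+ 2
  = normc v ^+ 2 - 2 * t * Re (conjc v * d) + t ^+ 2 * normc d ^+ 2.
Proof. by rewrite !normc_sqr; case: v d => [a b] [c e] /=; ring. Qed.

(* An almost nearest point w0 of W to y satisfies the variational inequality
   Re (conj (y - w0) (w - w0)) <= small for all w in W. *)
Lemma dist_convex_le (W : set C) (y : C) (K e h : R) :
  W !=set0 -> 0 <= e -> 0 < h ->
  (forall w w', W w -> W w' -> normc (w - w') <= K) ->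
  (forall w w' (t : R), W w -> W w' -> 0 <= t <= 1 ->
     W ((1 - t)%:C * w + t%:C * w')) ->
  (forall u : C, exists2 w, W w & Re (conjc u * (y - w)) <= normc u * e) ->
  exists2 w, W w & normc (y - w) <= e + h.
Proof.
move=> [w00 Ww00] e0 h0 WK Wcvx Wdir; apply: contrapT => far.
have {}far w : W w -> e + h < normc (y - w).
  by move=> Ww; rewrite ltNge; apply/negP => le; apply: far; exists w.
pose E := [set normc (y - w) ^+ 2 | w in W].
have infE : has_inf E.
  split; first by exists (normc (y - w00) ^+ 2), w00.
  by exists 0 => _ [w _ <-]; apply: sqr_ge0.
have K1 : 0 < K ^+ 2 + 1 by rewrite ltr_wpDl ?sqr_ge0.
(* Step length along the segment from [w0]: the second-order term costs at most [t * h ^+ 2], the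
   same as the allowed excess of [w0] over the infimum. *)
pose t := h ^+ 2 / (K ^+ 2 + 1 + h ^+ 2).
have den : 0 < K ^+ 2 + 1 + h ^+ 2 by rewrite addr_gt0 ?exprn_gt0.
have t0 : 0 < t by rewrite divr_gt0 ?exprn_gt0.
have t1 : t <= 1 by rewrite ler_pdivrMr// mul1r lerDr ltW.
have tK : t * K ^+ 2 <= h ^+ 2.
  rewrite mulrAC ler_pdivrMr// ler_wpM2l ?sqr_ge0//.
  by rewrite -addrA lerDl addr_ge0 ?sqr_ge0.
have [_ [w0 Ww0 <-] near] := inf_adherent (mulr_gt0 t0 (exprn_gt0 2 h0)) infE.
set v := y - w0 in near.
have [w1 Ww1 w1P] := Wdir v.
have := Wcvx _ _ t Ww0 Ww1; rewrite (ltW t0) t1 => /(_ isT) Wt.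
have := ge_inf infE.2 (imageP (fun w => normc (y - w) ^+ 2) Wt).
have -> : y - ((1 - t)%:C * w0 + t%:C * w1) = v - t%:C * (w1 - w0).
  by rewrite /v rmorphB /=; ring.
rewrite normc_sqrB_scale => infle.
have d2 : t ^+ 2 * normc (w1 - w0) ^+ 2 <= t * h ^+ 2.
  rewrite expr2 -mulrA ler_wpM2l ?(ltW t0)//; apply: le_trans tK.
  rewrite ler_wpM2l ?(ltW t0)// ler_sqr ?nnegrE ?normc_ge0 ?WK//.
  exact: le_trans (normc_ge0 _) (WK _ _ Ww1 Ww0).
have vE : Re (conjc v * (y - w1)) = normc v ^+ 2 - Re (conjc v * (w1 - w0)).
  rewrite normc_sqr /v; case: (y) (w0) (w1) => [? ?] [? ?] [? ?] /=; ring.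
have vh := far _ Ww0; rewrite -/v in vh.
(* Comparison with the infimum gives [Re (conjc v * (w1 - w0)) <= h ^+ 2]. The resulting bound is
   incompatible with [e + h < normc v]. *)
have key : normc v * (normc v - e) <= h ^+ 2.
  rewrite -(ler_pM2l t0); move: w1P; rewrite vE => w1P.
  have := ler_wpM2l (ltW t0) w1P.
  move: infle near d2; rewrite /E; nra.
nra.
Qed.

End NearestPoint.

(** * A polynomial that decays exponentially on the half disk *)

Section DecayingPolynomial.
Variable R : realType.
Local Notation C := R[i].

(** The left side is a polynomial in [x = Re z] and [rho], the squared modulus of [z];
    [rho ^+ 2 <= rho] and [x ^+ 2 <= rho] reduce the claim to the single variable [x] in [0, 1]. *)
Lemma normc_quadratic_le (z : C) : 0 <= Re z -> normc z <= 1 ->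
  normc (1 - z / 2 + z ^+ 2 / 4) ^+ 2 <= 1 - Re z / 3.
Proof.
move=> x0 z1.
have rho1 : Re z ^+ 2 + Im z ^+ 2 <= 1 by rewrite -normc_sqr expr_le1 ?normc_ge0.
have -> : 1 - z / 2 + z ^+ 2 / 4
    = 1 - z * (2^-1)%:C + z ^+ 2 * (4^-1)%:C.
  by rewrite !fmorphV !rmorph_nat.
rewrite normc_sqr; case: z x0 {z1} rho1 => x y /= x0 rho1.
pose rho := x ^+ 2 + y ^+ 2.
have x1 : x <= 1 by rewrite -(@expr_le1 _ 2)//; move: (sqr_ge0 y); lra.
have -> : (1 - (x * 2^-1 - y * 0) + ((x * x - y * y) * 4^-1 - (x * y + y * x) * 0)) ^+ 2
  + (0 - (x * 0 + y * 2^-1) + ((x * x - y * y) * 0 + (x * y + y * x) * 4^-1)) ^+ 2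
  = 1 - rho / 4 + rho ^+ 2 / 16 + x ^+ 2 - x - rho * x / 4.
  by rewrite /rho; field.
have h1 : rho ^+ 2 <= rho by rewrite expr2 ler_piMl ?addr_ge0 ?sqr_ge0.
have h2 : x ^+ 2 <= rho by rewrite lerDl sqr_ge0.
have h3 : 0 <= rho * x by rewrite mulr_ge0 ?addr_ge0 ?sqr_ge0.
have h4 : x ^+ 2 * x <= rho * x by rewrite ler_wpM2r.
have : x * (13 / 16 * x - 2 / 3 - x ^+ 2 / 4) <= 0.
  by rewrite mulr_ge0_le0//; have := sqr_ge0 (1 - x); lra.
rewrite !mulrBr; lra.
Qed.

(** Each factor has squared modulus at most [expR (- (Re z / 3))]; the exponent [3 * k] absorbs the
    third. *)
Lemma normc_quadraticX_le (z : C) k : 0 <= Re z -> normc z <= 1 ->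
  normc ((1 - z / 2 + z ^+ 2 / 4) ^+ (3 * k)) ^+ 2 <= expR (- (k%:R * Re z)).
Proof.
move=> x0 z1; rewrite normcX exprAC.
apply: (@le_trans _ _ (expR (- (Re z / 3)) ^+ (3 * k))).
  apply: lerXn2r; rewrite ?nnegrE ?exprn_ge0 ?normc_ge0 ?expR_ge0//.
  apply: le_trans (normc_quadratic_le x0 z1) _.
  exact: expR_ge1Dx.
rewrite -expRM_natr natrM le_eqVlt; apply/orP; left; apply/eqP; congr expR.
by field.
Qed.

(** The degree is at most [2 * (3 * k) = 6 * k]: for [k = m], the largest degree that the Krylov
    space of order [6 * m + 1] admits. *)
Lemma size_quadraticX_le (a b : C) k :
  (size ((1 - (a *: (b%:P - 'X)) * (2^-1)%:P + (a *: (b%:P - 'X)) ^+ 2 * (4^-1)%:P)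
     ^+ (3 * k)) <= (6 * k).+1)%N.
Proof.
set l := a *: _; apply: leq_trans (size_poly_exp_leq _ _) _.
have sl : (size l <= 2)%N.
  apply: leq_trans (size_scale_leq _ _) _; rewrite -size_polyN opprB.
  by rewrite size_XsubC.
have -> : (6 * k = 2 * (3 * k))%N by lia.
rewrite ltnS leq_mul2r; apply/orP; right.
rewrite -subn1 leq_subLR add1n.
apply: leq_trans (size_polyD _ _) _; rewrite geq_max; apply/andP; split.
  apply: leq_trans (size_polyD _ _) _; rewrite geq_max size_poly1 size_polyN /=.
  apply: leq_trans (size_polyMleq _ _) _.
  apply: (@leq_trans (2 + 1).-1) => //.
  by rewrite -!subn1 leq_sub2r// leq_add// size_polyC_leq1.
apply: leq_trans (size_polyMleq _ _) _.
apply: (@leq_trans (3 + 1).-1) => //.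
rewrite -!subn1 leq_sub2r// leq_add// ?size_polyC_leq1//.
apply: leq_trans (size_polyMleq _ _) _.
apply: (@leq_trans (2 + 2).-1) => //.
by rewrite -!subn1 leq_sub2r// leq_add.
Qed.

End DecayingPolynomial.

(** * Rayleigh quotients of a diagonal matrix as weighted means *)

Section DiagonalRayleigh.
Variable R : realType.
Variable n : nat.
Local Notation C := R[i].
Implicit Types (L : 'rV[C]_n) (c : 'cV[C]_n).

Lemma dotv_diag L c :
  dotv c (diag_mx L *m c) = \sum_j L 0 j * (normc (c j 0) ^+ 2)%:C.
Proof.
rewrite dotvE; apply: eq_bigr => j _.
by rewrite mul_diag_mx mxE -mulJc mulrCA.
Qed.

(** The quotient is the mean of the [L 0 j] with weights [normc (c j 0) ^+ 2]; multiplying by the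
    total weight clears the division. *)
Lemma Re_rayleigh_diag L c (u z : C) : c != 0 ->
  Re (conjc u * (z - rayleigh (diag_mx L) c)) * l2norm c ^+ 2
  = \sum_j normc (c j 0) ^+ 2 * Re (conjc u * (z - L 0 j)).
Proof.
move=> c0; set N := l2norm c ^+ 2.
have -> : Re (conjc u * (z - rayleigh (diag_mx L) c)) * N
    = Re (conjc u * (z - rayleigh (diag_mx L) c) * N%:C).
  by rewrite [RHS]Re_M /= mulr0 subr0.
rewrite -mulrA mulrBl /N -dotvv divfK ?dotvv_neq0//.
rewrite dotv_diag dotvv l2norm_sqr rmorph_sum mulr_sumr -sumrB mulr_sumr Re_sum.
apply: eq_bigr => j _; rewrite -mulrBl mulrA [LHS]Re_M /= mulr0 subr0.
by rewrite mulrC.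
Qed.

(* Weighting by exp (- m x) costs only ln s: t exp (1 - t) <= 1 is applied at
   t = m (x - e) with e = (ln s - 1) / m. *)
Lemma weighted_mean_le (I : finType) (v a x : I -> R) (i0 : I) (m s : R) :
  0 < m -> (forall j, 0 <= v j) -> v i0 = a i0 -> 0 < a i0 ->
  (forall j, v j <= a j * expR (- (m * x j))) -> (forall j, 0 <= a j) ->
  \sum_j a j <= s * a i0 ->
  \sum_j v j * x j <= ln s / m * \sum_j v j.
Proof.
move=> m0 v0 vi0 ai0 va a0 as0.
have s0 : 0 < s.
  rewrite -(pmulr_lgt0 _ ai0); apply: lt_le_trans as0.
  by rewrite (bigD1 i0)//= ltr_wpDr// sumr_ge0.
pose e := (ln s - 1) / m.
have vxe j : v j * (x j - e) <= a j / (s * m).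
  have sm0 : 0 < s * m by rewrite mulr_gt0.
  have [xe|ex] := leP (x j) e.
    apply: (@le_trans _ _ 0); first by rewrite mulr_ge0_le0// subr_le0.
    by rewrite divr_ge0// ltW.
  have xe0 : 0 <= x j - e by rewrite subr_ge0 ltW.
  apply: le_trans (ler_wpM2r xe0 (va j)) _; rewrite -mulrA ler_wpM2l//.
  pose t := m * (x j - e).
  have -> : x j - e = t / m by rewrite /t; field; rewrite gt_eqF.
  have -> : - (m * x j) = (1 - t) - ln s.
    by rewrite /t /e; field; rewrite gt_eqF.
  rewrite expRD expRN lnK ?posrE//.
  rewrite invfM mulrCA mulrA ler_wpM2r ?invr_ge0 ?(ltW m0)//.
  rewrite mulrA ler_piMl ?invr_ge0 ?(ltW s0)//.
  rewrite -(opprB t 1) expRN ler_pdivrMr ?expR_gt0// mul1r.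
  by have := expR_ge1Dx (t - 1); rewrite addrCA subrr addr0.
have : \sum_j v j * (x j - e) <= \sum_j a j / (s * m).
  by apply: ler_sum => j _; exact: vxe.
rewrite -mulr_suml; under eq_bigr do rewrite mulrBr.
rewrite sumrB -mulr_suml => h.
(* The index [i0] enters here: [\sum_j a j <= s * a i0 = s * v i0 <= s * \sum_j v j]. The extra
   [1 / m] then completes [e] to [ln s / m]. *)
have h2 : (\sum_j a j) / (s * m) <= (\sum_j v j) / m.
  rewrite invfM mulrA ler_wpM2r ?invr_ge0 ?(ltW m0)// ler_pdivrMr//.
  apply: le_trans as0 _; rewrite mulrC ler_wpM2r ?(ltW s0)// -vi0 (bigD1 i0)//=.
  by rewrite lerDl sumr_ge0.
have -> : ln s / m * \sum_j v j = (\sum_j v j) * e + (\sum_j v j) / m.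
  by rewrite /e; field; rewrite gt_eqF.
by rewrite -lerBlDl; apply: le_trans h h2.
Qed.

(** For [c = invmx V *m b], these are the coordinates of p(A) b in the eigenbasis. *)
Definition poly_col L c (p : {poly C}) : 'cV[C]_n := \col_j (p.[L 0 j] * c j 0).

(** The weight of the extremal index [i0] is kept, the [j]-th one is damped by
    [expR (- (m * Re (z j)))], so [weighted_mean_le] bounds the mean of the [Re (z j)] by
    [ln s / m]; the factor [E = normc u * D] restores the scale. *)
Lemma poly_col_direction L c (m : nat) (s D : R) (u : C) :
  (0 < n)%N -> (0 < m)%N -> (forall i j, normc (L 0 i - L 0 j) <= D) ->
  (forall j, c j 0 != 0) ->
  (forall j, l2norm c ^+ 2 <= s * normc (c j 0) ^+ 2) ->
  exists p : {poly C}, [/\ (size p <= (6 * m).+1)%N, poly_col L c p != 0 &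
    forall i, Re (conjc u * (L 0 i - rayleigh (diag_mx L) (poly_col L c p)))
              <= normc u * (ln s / m%:R * D)].
Proof.
move=> n0 m0 LD c0 cs.
have [i0 _ i0P] := @arg_maxP _ _ _ (Ordinal n0) xpredT
  (fun i => Re (conjc u * L 0 i)) isT.
pose E := normc u * D.
have D0 : 0 <= D by apply: le_trans (LD i0 i0); exact: normc_ge0.
have E0 : 0 <= E by rewrite mulr_ge0 ?normc_ge0.
(* When [E = 0] the division yields [z j = 0], which is consistent: then
   [conjc u * (L 0 i0 - L 0 j)] vanishes as well. *)
pose z j := conjc u / E%:C * (L 0 i0 - L 0 j).
have uE j : conjc u * (L 0 i0 - L 0 j) = E%:C * z j.
  have [e0|e0] := eqVneq E 0.
    rewrite e0 mul0r; apply/eqP; rewrite -normc_eq0 eq_le normc_ge0 andbT.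
    by rewrite normcM normcJ -e0 ler_wpM2l ?normc_ge0.
  by rewrite /z mulrA mulrCA divff ?mulr1//; apply: contra_neq e0 => -[].
have Rez j : Re (conjc u * (L 0 i0 - L 0 j)) = E * Re (z j).
  by rewrite uE Re_M /= mul0r subr0.
have z0 j : 0 <= Re (z j).
  have [e0|e0] := eqVneq E 0; first by rewrite /z e0 invr0 mulr0 mul0r.
  rewrite -(@pmulr_rge0 _ E) ?lt_def ?e0// -Rez mulrBr Re_D Re_N subr_ge0.
  exact: i0P.
have z1 j : normc (z j) <= 1.
  have [e0|e0] := eqVneq E 0; first by rewrite /z e0 invr0 mulr0 mul0r normc0.
  have E0' : 0 < E by rewrite lt_def e0.
  rewrite -(ler_pM2l E0') mulr1 -{1}(ger0_norm E0) -normc_real -normcM -uE.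
  by rewrite normcM normcJ ler_wpM2l ?normc_ge0.
pose l := (conjc u / E%:C) *: ((L 0 i0)%:P - 'X).
pose p := (1 - l * (2^-1)%:P + l ^+ 2 * (4^-1)%:P) ^+ (3 * m).
have pE j : p.[L 0 j] = (1 - z j / 2 + z j ^+ 2 / 4) ^+ (3 * m).
  by rewrite /p /l !hornerE.
have pi0 : p.[L 0 i0] = 1.
  by rewrite pE /z subrr mulr0 mul0r expr0n mul0r subr0 addr0 expr1n.
have q0 : poly_col L c p != 0.
  apply: contra_neq (c0 i0) => /matrixP/(_ i0 0).
  by rewrite !mxE pi0 mul1r.
exists p; split=> // [|i]; first exact: size_quadraticX_le.
have N0 : 0 < l2norm (poly_col L c p) ^+ 2 by rewrite exprn_gt0 ?l2norm_gt0.
rewrite -(ler_pM2r N0) Re_rayleigh_diag//.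
set v := fun j => normc (poly_col L c p j 0) ^+ 2.
apply: (@le_trans _ _ (\sum_j v j * (E * Re (z j)))).
  apply: ler_sum => j _; rewrite ler_wpM2l ?sqr_ge0// -Rez !mulrBr !Re_D.
  by rewrite lerD2r; exact: i0P.
under eq_bigr do rewrite mulrCA.
rewrite -mulr_sumr l2norm_sqr.
have -> : normc u * (ln s / m%:R * D) * (\sum_i v i)
    = E * (ln s / m%:R * \sum_j v j) by rewrite /E; ring.
rewrite ler_wpM2l//.
apply: (@weighted_mean_le _ v (fun j => normc (c j 0) ^+ 2) _ i0) => /=.
- by rewrite ltr0n.
- by move=> j; rewrite sqr_ge0.
- by rewrite /v mxE pi0 mul1r.
- by rewrite exprn_gt0// normc_gt0.
- move=> j; rewrite /v mxE pE normcM exprMn mulrC ler_wpM2l ?sqr_ge0//.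
  exact: normc_quadraticX_le.
- by move=> j; rewrite sqr_ge0.
- by rewrite -l2norm_sqr.
Qed.

End DiagonalRayleigh.

(** * Spectral norm, condition number and change of basis *)

Section SpectralNorm.
Variable R : realType.
Variable n : nat.
Local Notation C := R[i].
Implicit Types (M V : 'M[C]_n) (x c d : 'cV[C]_n).

Lemma l2norm_le_sum x : l2norm x <= \sum_i normc (x i 0).
Proof.
have S0 (P : pred 'I_n) : 0 <= \sum_(i | P i) normc (x i 0).
  by apply: sumr_ge0 => i _; apply: normc_ge0.
rewrite -ler_sqr ?nnegrE ?l2norm_ge0// l2norm_sqr [leRHS]expr2 mulr_suml.
apply: ler_sum => i _; rewrite expr2 ler_wpM2l ?normc_ge0//.
by rewrite (bigD1 i)//= lerDl.
Qed.

Lemma l2norm_mulmx_le M x : l2norm (M *m x) <= spectral_norm M * l2norm x.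
Proof.
have [->|x0] := eqVneq x 0; first by rewrite mulmx0 !l2norm0 mulr0.
have Nx : 0 < l2norm x by rewrite l2norm_gt0.
pose y := (l2norm x)^-1%:C *: x.
have y1 : l2norm y = 1.
  by rewrite l2normZ normc_real ger0_norm ?invr_ge0 ?(ltW Nx)// mulVf ?gt_eqF.
have -> : l2norm (M *m x) = l2norm (M *m y) * l2norm x.
  rewrite -scalemxAr l2normZ normc_real ger0_norm ?invr_ge0 ?(ltW Nx)//.
  by rewrite mulrAC mulVf ?mul1r ?gt_eqF.
rewrite ler_wpM2r ?(ltW Nx)//; apply: ub_le_sup; last by exists y.
(* The sum of the moduli of all entries bounds the set, so that [sup] is a true supremum and not a
   default value. *)
exists (\sum_i \sum_j normc (M i j)) => _ [z /= z1 <-].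
apply: le_trans (l2norm_le_sum _) _; apply: ler_sum => i _.
rewrite mxE; apply: le_trans (le_normc_sum _ _ _) _; apply: ler_sum => j _.
by rewrite normcM ler_piMr ?normc_ge0// -z1 normc_le_l2norm.
Qed.

Lemma l2norm_le_inv V x : V \in unitmx ->
  l2norm x <= spectral_norm (invmx V) * l2norm (V *m x).
Proof. by move=> uV; rewrite -{1}(mulKmx uV x) l2norm_mulmx_le. Qed.

Lemma l2norm_delta i : l2norm (delta_mx i 0 : 'cV[C]_n) = 1.
Proof.
apply/eqP; rewrite -(@eqrXn2 _ 2) ?l2norm_ge0// expr1n; apply/eqP.
by apply: (@complexI R); rewrite -dotvv dotv_delta mxE !eqxx.
Qed.

Lemma spectral_norm_ge_col M j : l2norm (col j M) <= spectral_norm M.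
Proof.
by have := l2norm_mulmx_le M (delta_mx j 0); rewrite -colE l2norm_delta mulr1.
Qed.

(** [invmx V] sends the unit column [j] to a unit basis vector. *)
Lemma spectral_norm_inv_ge1 V j : V \in unitmx -> l2norm (col j V) = 1 ->
  1 <= spectral_norm (invmx V).
Proof.
move=> uV h; have := l2norm_mulmx_le (invmx V) (col j V).
by rewrite h mulr1 colE mulKmx// l2norm_delta.
Qed.

Lemma cond_ge1 V j : V \in unitmx -> l2norm (col j V) = 1 -> 1 <= cond V.
Proof.
move=> uV h; have s1 : 1 <= spectral_norm V by rewrite -h spectral_norm_ge_col.
have i1 := spectral_norm_inv_ge1 uV h.
rewrite /cond; move: s1 i1; move: (spectral_norm V) (spectral_norm _) => s q.
by nra.
Qed.

(* The part of diag_mx L *m c orthogonal to c is what V can tilt: parallelogram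
   differences of |V (c + t d)|^2 bound the tilted inner product. *)
Lemma rayleigh_similarity V (A : 'M[C]_n) (L : 'rV[C]_n) c (z : C) (s q r : R) :
  (forall x, l2norm (V *m x) <= s * l2norm x) ->
  (forall x, l2norm x <= q * l2norm (V *m x)) -> A *m V = V *m diag_mx L -> c != 0 ->
  (forall j, normc (L 0 j - z) <= r) -> 0 <= r ->
  normc (rayleigh A (V *m c) - rayleigh (diag_mx L) c)
    <= ((s * q) ^+ 2 - 1) / 2 * r /\
  normc (rayleigh (diag_mx L) c - z) <= r.
Proof.
move=> Vs Vq AV c0 Lr r0; set w := rayleigh _ c.
pose d := diag_mx L *m c - w *: c.
have Nc : 0 < l2norm c by rewrite l2norm_gt0.
have cd : dotv c d = 0.
  by rewrite /d dotvBr dotvZr /w /rayleigh divfK ?subrr// dotvv_neq0.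
have dc : dotv d c = 0 by rewrite dotvC cd conjc0.
(* The vector has entries [(L 0 j - z) * c j 0]. As [d] is orthogonal to [c], Pythagoras then bounds
   [d] and [w - z] at once. *)
have Ldz : l2norm (d + (w - z) *: c) <= r * l2norm c.
  rewrite -ler_sqr ?nnegrE ?mulr_ge0 ?l2norm_ge0//.
  rewrite exprMn !l2norm_sqr mulr_sumr; apply: ler_sum => j _.
  have -> : (d + (w - z) *: c) j 0 = (L 0 j - z) * c j 0.
    by rewrite /d mul_diag_mx !mxE; ring.
  rewrite normcM exprMn ler_wpM2r ?sqr_ge0//.
  by apply: lerXn2r; rewrite ?nnegrE ?normc_ge0.
have pyth : l2norm d ^+ 2 + normc (w - z) ^+ 2 * l2norm c ^+ 2
    <= r ^+ 2 * l2norm c ^+ 2.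
  have <- : l2norm (d + (w - z) *: c) ^+ 2
      = l2norm d ^+ 2 + normc (w - z) ^+ 2 * l2norm c ^+ 2.
    by rewrite l2norm_sqrD dotvZr dc mulr0 mulr0 addr0 l2normZ exprMn.
  by rewrite -exprMn lerXn2r ?nnegrE ?mulr_ge0 ?l2norm_ge0.
have dr : l2norm d ^+ 2 <= r ^+ 2 * l2norm c ^+ 2.
  apply: le_trans pyth; rewrite lerDl mulr_ge0 ?sqr_ge0//.
split; last first.
  have c2 : 0 < l2norm c ^+ 2 by rewrite exprn_gt0.
  rewrite -ler_sqr ?nnegrE ?normc_ge0// -(ler_pM2r c2); apply: le_trans pyth.
  by rewrite lerDr sqr_ge0.
have NVc : 0 < l2norm (V *m c).
  rewrite lt_def l2norm_ge0 andbT; apply/eqP => h.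
  by have := Vq c; rewrite h mulr0 leNgt Nc.
have Vc0 : V *m c != 0 by rewrite -l2norm_gt0.
set P := dotv (V *m c) (V *m d).
have diffE : rayleigh A (V *m c) - w = P / dotv (V *m c) (V *m c).
  have -> : w = w * dotv (V *m c) (V *m c) / dotv (V *m c) (V *m c).
    by rewrite mulfK ?dotvv_neq0.
  rewrite /rayleigh -mulrBl mulmxA AV -mulmxA; congr (_ / _).
  by rewrite /P /d mulmxBr -scalemxAr dotvBr dotvZr.
rewrite diffE normcM normcV dotvv normc_real ger0_norm ?sqr_ge0//.
rewrite ler_pdivrMr ?exprn_gt0//.
have s0 : 0 <= s.
  by rewrite -(pmulr_lge0 _ Nc) (le_trans _ (Vs c))// l2norm_ge0.
have q_gt0 : 0 < q.
  by rewrite -(pmulr_lgt0 _ NVc) (lt_le_trans _ (Vq c)).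
have q0 := ltW q_gt0.
have up x : q ^+ 2 * l2norm (V *m x) ^+ 2 <= (s * q) ^+ 2 * l2norm x ^+ 2.
  rewrite -!exprMn lerXn2r ?nnegrE ?mulr_ge0 ?l2norm_ge0//.
  by rewrite (mulrC s) -mulrA ler_wpM2l.
have lo x : l2norm x ^+ 2 <= q ^+ 2 * l2norm (V *m x) ^+ 2.
  by rewrite -exprMn lerXn2r ?nnegrE ?mulr_ge0 ?l2norm_ge0.
have k1 : 0 <= (s * q) ^+ 2 - 1.
  have c2 : 0 < l2norm c ^+ 2 by rewrite exprn_gt0.
  by rewrite subr_ge0 -(ler_pM2r c2) mul1r (le_trans (lo c)).
move: ((s * q) ^+ 2) up k1 => k up k1.
(* By orthogonality [c + t *: d] and [c - t *: d] have equal norms. Subtracting the lower bound at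
   the second from the upper bound at the first leaves only the cross term. *)
have polar (t : C) : 4 * q ^+ 2 * Re (t * P)
    <= (k - 1) * (l2norm c ^+ 2 + normc t ^+ 2 * l2norm d ^+ 2).
  have VE (a : C) : l2norm (V *m (c + a *: d)) ^+ 2 = l2norm (V *m c) ^+ 2
      + normc a ^+ 2 * l2norm (V *m d) ^+ 2 + 2 * Re (a * P).
    by rewrite mulmxDr -scalemxAr l2norm_sqrD dotvZr l2normZ exprMn.
  have E (a : C) : l2norm (c + a *: d) ^+ 2
      = l2norm c ^+ 2 + normc a ^+ 2 * l2norm d ^+ 2.
    by rewrite l2norm_sqrD dotvZr cd l2normZ exprMn mulr0 /= mulr0 addr0.
  have := up (c + t *: d); have := lo (c + (- t) *: d).
  rewrite (E t) (E (- t)) (VE t) (VE (- t)) (mulNr t) Re_N (normcN t).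
  by rewrite !(mulrDr, mulrDl, mulrN, mulNr, mul1r); lra.
have [P0|P0] := eqVneq P 0.
  by rewrite P0 normc0 mulr_ge0 ?sqr_ge0// mulr_ge0// divr_ge0.
have NP : 0 < normc P by rewrite normc_gt0.
have r_gt0 : 0 < r.
  rewrite lt_def r0 andbT; apply: contra_neq P0 => re0.
  have : l2norm d ^+ 2 <= 0 by rewrite (le_trans dr)// re0 expr0n mul0r.
  rewrite le_eqVlt ltNge sqr_ge0 orbF sqrf_eq0 => /eqP d0.
  have : d == 0 by rewrite -[_ == _]negbK -l2norm_gt0 d0 ltxx.
  by rewrite /P => /eqP ->; rewrite mulmx0 /dotv mulmx0 mxE.
(* The phase makes [t * P] real and positive; the modulus [r^-1] makes
   [normc t ^+ 2 * l2norm d ^+ 2] at most [l2norm c ^+ 2]. *)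
pose t := ((r * normc P)^-1)%:C * conjc P.
have tP : Re (t * P) = normc P / r.
  rewrite /t -mulrA mulJc Re_M /= mul0r subr0.
  by field; rewrite !gt_eqF.
have Nt : normc t = r^-1.
  rewrite /t normcM normcJ normc_real ger0_norm ?invr_ge0 ?mulr_ge0 ?normc_ge0//.
  by field; rewrite !gt_eqF.
have := polar t; rewrite tP Nt => h.
have {}h : 4 * q ^+ 2 * (normc P / r) <= (k - 1) * (2 * (q ^+ 2 * l2norm (V *m c) ^+ 2)).
  apply: le_trans h _; rewrite ler_wpM2l//.
  have : r^-1 ^+ 2 * l2norm d ^+ 2 <= l2norm c ^+ 2.
    by rewrite exprVn mulrC ler_pdivrMr ?exprn_gt0// mulrC.
  by have := lo c; lra.
have q4 : 0 < 4 * q ^+ 2 by rewrite mulr_gt0 ?exprn_gt0.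
rewrite -(ler_pM2l q4).
have := ler_wpM2l (ltW r_gt0) h.
have -> : r * (4 * q ^+ 2 * (normc P / r)) = 4 * q ^+ 2 * normc P.
  by field; rewrite gt_eqF.
by move=> /le_trans; apply; rewrite le_eqVlt; apply/orP; left; apply/eqP; field.
Qed.

End SpectralNorm.

(** * Krylov spaces as polynomial images, and their numerical ranges *)

Section Krylov.
Variable R : realType.
Variable n : nat.
Local Notation C := R[i].
Implicit Types (A V : 'M[C]_n) (L : 'rV[C]_n) (b c x : 'cV[C]_n).

Lemma poly_colD L c (p q : {poly C}) :
  poly_col L c (p + q) = poly_col L c p + poly_col L c q.
Proof. by apply/colP => j; rewrite !mxE hornerD mulrDl. Qed.

Lemma poly_colZ L c (a : C) (p : {poly C}) :
  poly_col L c (a *: p) = a *: poly_col L c p.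
Proof. by apply/colP => j; rewrite !mxE hornerZ mulrA. Qed.

Lemma poly_col0 L c : poly_col L c 0 = 0.
Proof. by apply/colP => j; rewrite !mxE horner0 mul0r. Qed.

Lemma poly_col_sum L c (I : finType) (F : I -> {poly C}) :
  poly_col L c (\sum_i F i) = \sum_i poly_col L c (F i).
Proof. exact: (big_morph _ (poly_colD L c) (poly_col0 L c)). Qed.

Lemma iter_mulmx_diag A V L c i : A *m V = V *m diag_mx L ->
  iter i (mulmx A) (V *m c) = V *m poly_col L c 'X^i.
Proof.
move=> AV; elim: i => [|i IH] /=.
  by congr (_ *m _); apply/colP => j; rewrite mxE hornerXn expr0 mul1r.
rewrite IH mulmxA AV -mulmxA; congr (_ *m _); apply/colP => j.
by rewrite mul_diag_mx !mxE !hornerXn exprS mulrA.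
Qed.

(** The [i]-th spanning vector belongs to ['X^i], so the coefficients of [p] are coordinates in the
    span. *)
Lemma krylovP A V L c k x : A *m V = V *m diag_mx L ->
  x \in krylov A (V *m c) k <->
  exists2 p : {poly C}, (size p <= k)%N & x = V *m poly_col L c p.
Proof.
move=> AV; rewrite /krylov; set s := mkseq _ _.
have sE i : (i < k)%N -> s`_i = V *m poly_col L c 'X^i.
  by move=> ik; rewrite nth_mkseq// (iter_mulmx_diag _ _ AV).
have ss : size s = k by rewrite size_mkseq.
split=> [xs|[p pk ->]].
  have := @coord_span _ _ _ (in_tuple s) x xs.
  move: (coord _) => a ->.
  exists (\sum_(i < size s) a i x *: 'X^i).
    apply: leq_trans (size_sum _ _ _) _; apply/bigmax_leqP => i _.
    by apply: leq_trans (size_scale_leq _ _) _; rewrite size_polyXn -ss ltn_ord.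
  rewrite poly_col_sum mulmx_sumr; apply: eq_bigr => i _.
  by rewrite poly_colZ -scalemxAr -sE// -ss ltn_ord.
have -> : p = \sum_(i < k) p`_i *: 'X^i.
  rewrite -{1}(coefK p) poly_def (big_ord_widen k (fun i => p`_i *: 'X^i)) //.
  rewrite big_mkcond; apply: eq_bigr => i _; case: ltnP => // pi.
  by rewrite nth_default// scale0r.
rewrite poly_col_sum mulmx_sumr; apply: rpred_sum => i _.
rewrite poly_colZ -scalemxAr rpredZ// -sE// memv_span// mem_nth// ss.
exact: ltn_ord.
Qed.

Lemma numrangeE A : numrange A = [set rayleigh A x | x in [set x | x != 0]].
Proof. by apply: eq_imagel => x _; rewrite /rayleigh /dotv mulmxA. Qed.

(** [Q] is an isometry from the coordinate space onto [K], and it carries the quadratic form of the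
    compression to that of [A]. *)
Lemma numrange_compression r (K : {vspace 'cV[C]_n}) A (Q : 'M[C]_(n, r)) :
  orthonormal_basis K Q ->
  numrange (compression A Q)
  = [set rayleigh A x | x in [set x : 'cV[C]_n | x != 0 /\ x \in K]].
Proof.
move=> [QQ bQ].
have mulE (u : 'cV[C]_r) : Q *m u = \sum_j u j 0 *: col j Q.
  apply/colP => i; rewrite mxE summxE; apply: eq_bigr => j _.
  by rewrite !mxE mulrC.
have Qdot (u v : 'cV[C]_r) : dotv (Q *m u) (Q *m v) = dotv u v.
  by rewrite dotv_mulmx mulmxA QQ mul1mx.
have rE (u : 'cV[C]_r) :
    (u^t* *m compression A Q *m u) 0 0 / (u^t* *m u) 0 0 = rayleigh A (Q *m u).
  rewrite /rayleigh Qdot dotv_mulmx /dotv /compression; congr (_ / _).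
  by rewrite !mulmxA.
have Q0 (u : 'cV[C]_r) : Q *m u != 0 -> u != 0.
  by apply: contra_neq => ->; rewrite mulmx0.
apply/seteqP; split => [_ [u /= u0 <-]|_ [x /= [x0 xK] <-]].
  exists (Q *m u); last by rewrite rE.
  split; first by apply: contra_neq u0 => e; rewrite -(mul1mx u) -QQ -mulmxA e mulmx0.
  rewrite mulE; apply: rpred_sum => j _; rewrite rpredZ//.
  by apply: (basis_mem bQ); apply/mapP; exists j; rewrite ?mem_enum.
have [u xE] : exists u, x = Q *m u.
  set s := [seq col j Q | j : 'I_r] in bQ.
  have xs : x \in <<in_tuple s>>%VS by rewrite (span_basis bQ).
  have := coord_span xs; move: (coord _) => a ->.
  have ss : size s = r by rewrite size_map size_enum_ord.
  exists (\col_j a (cast_ord (esym ss) j) x); rewrite mulE.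
  rewrite (reindex (cast_ord ss)) /=; last first.
    by exists (cast_ord (esym ss)) => i _; rewrite ?cast_ordK ?cast_ordKV.
  apply: eq_bigr => i _; rewrite mxE cast_ordK; congr (_ *: _).
  rewrite (nth_map (cast_ord ss i)) ?size_enum_ord -?ss//.
  congr (col _ Q); apply: val_inj => /=; rewrite nth_enum_ord// -[X in (_ < X)%N]ss.
  exact: ltn_ord.
exists u; last by rewrite rE -xE.
by apply: Q0; rewrite -xE.
Qed.

(** The right side is free of [Q]: the numerical range depends on the Krylov space alone. *)
Lemma krylov_numrange A V L (b : 'cV[C]_n) k
    (Q : 'M[C]_(n, \dim (krylov A b k))) :
  V \in unitmx -> A *m V = V *m diag_mx L ->
  (b != 0 -> orthonormal_basis (krylov A b k) Q) ->
  numrange (compression A Q)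
  = [set rayleigh A (V *m poly_col L (invmx V *m b) p) | p in
      [set p : {poly C} | (size p <= k)%N /\ poly_col L (invmx V *m b) p != 0]].
Proof.
move=> uV AV hQ; set c := invmx V *m b.
have bE : b = V *m c by rewrite /c mulKVmx.
have Kp x : x \in krylov A b k <-> exists2 p : {poly C}, (size p <= k)%N & x = V *m poly_col L c p.
  by rewrite {1}bE; exact: krylovP.
have V0 x : (V *m x != 0) = (x != 0).
  congr (~~ _); apply/eqP/eqP => [e|->]; last by rewrite mulmx0.
  by rewrite -(mulKmx uV x) e mulmx0.
have -> : numrange (compression A Q)
    = [set rayleigh A x | x in [set x : 'cV[C]_n | x != 0 /\ x \in krylov A b k]].
  (* For [b = 0] the Krylov space is zero and [Q] has no columns, so both sides are empty. *)
  have [b0|b0] := eqVneq b 0; last exact: numrange_compression (hQ b0).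
  have K0 : krylov A b k = 0%VS.
    apply/eqP; rewrite -subv0; apply/subvP => x /Kp[p _ ->].
    rewrite memv0 /c b0 mulmx0 (_ : poly_col _ _ _ = 0) ?mulmx0//.
    by apply/colP => j; rewrite !mxE mulr0.
  have d0 : \dim (krylov A b k) = 0%N by rewrite K0 dimv0.
  apply/seteqP; split => [z [u /= u0 _]|z [x /= [x0 xK] _]]; exfalso.
    move/eqP: u0; apply; apply/matrixP => i; exfalso.
    by case: i => i; rewrite d0.
  by move: xK; rewrite K0 memv0 (negbTE x0).
apply/seteqP; split => [_ [x /= [x0 /Kp[p pk xE]] <-]|_ [p /= [pk p0] <-]].
  by exists p; rewrite -?xE//=; split => //; rewrite -V0 -xE.
by exists (V *m poly_col L c p) => //=; rewrite V0; split => //; apply/Kp; exists p.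
Qed.

End Krylov.

(** * Triangle inequalities for differences *)

Section TriangleInequality.
Variable R : realType.
Implicit Types w x y z : R[i].

Lemma normcB_le x y z (d e : R) :
  normc (x - z) <= d -> normc (y - z) <= e -> normc (x - y) <= d + e.
Proof.
move=> xz yz; have -> : x - y = (x - z) - (y - z) by ring.
by apply: le_trans (le_normcD _ _) _; rewrite normcN lerD.
Qed.

Lemma normc_chain w x y z (d e f : R) :
  normc (w - x) <= d -> normc (x - y) <= e -> normc (z - y) <= f ->
  normc (w - z) <= d + e + f.
Proof.
move=> wx xy zy; have -> : w - z = (w - x) + (x - y) - (z - y) by ring.
apply: le_trans (le_normcD _ _) _.
by rewrite normcN lerD// (le_trans (le_normcD _ _))// lerD.
Qed.

End TriangleInequality.

(** * Hausdorff distance of nested sets *)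

Section Hausdorff.
Variable R : realType.
Local Notation C := R[i].
Implicit Types (X Y : set C).

(** Points of [X] are at distance zero from [Y], so only the points of [Y] count; the slack [h]
    allows for an infimum that is not attained. *)
Lemma hausdorff_le X Y (e : R) : 0 <= e -> X `<=` Y ->
  (forall y, Y y -> forall h, 0 < h -> exists2 x, X x & normc (y - x) <= e + h) ->
  (hausdorff X Y <= e%:E)%E.
Proof.
move=> e0 XY near; rewrite /hausdorff ge_max; apply/andP; split.
  apply: ge_ereal_sup => _ [x Xx <-]; apply: le_trans (_ : 0%:E <= _)%E.
    by apply: ereal_inf_lbound; exists x; rewrite ?subrr ?normc0//; apply: XY.
  by rewrite lee_fin.
apply: ge_ereal_sup => _ [y Yy <-]; apply/lee_addgt0Pr => h h0.
have [x Xx xP] := near y Yy h h0.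
apply: (@le_trans _ _ (normc (y - x))%:E); first by apply: ereal_inf_lbound; exists x.
by rewrite -EFinD lee_fin.
Qed.

End Hausdorff.

(** * Approximating the numerical range from the Krylov space *)

Section DeterministicBound.
Variable R : realType.
Local Notation C := R[i].
Variables (m n : nat) (A V : 'M[C]_n) (L : 'rV[C]_n).
Hypotheses (m0 : (0 < m)%N) (n0 : (0 < n)%N).
Hypotheses (uV : V \in unitmx) (AV : A *m V = V *m diag_mx L).

(** Three legs: from [A] to the diagonal matrix at [y], across the convex set [W] to a Krylov
    vector, and back to [A]. Each change of matrix costs [(cond V ^+ 2 - 1) / 2 * D], the middle leg
    [ln s / m%:R * D + h]. *)
Lemma rayleigh_krylov_near (D s : R) (c x : 'cV[C]_n) (h : R) :
  (forall i j, normc (L 0 i - L 0 j) <= D) -> (forall j, c j 0 != 0) ->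
  (forall j, l2norm c ^+ 2 <= s * normc (c j 0) ^+ 2) -> x != 0 -> 0 < h ->
  exists p : {poly C}, [/\ (size p <= 6 * m + 1)%N, poly_col L c p != 0 &
    normc (rayleigh A x - rayleigh A (V *m poly_col L c p))
      <= (ln s / m%:R + (cond V ^+ 2 - 1)) * D + h].
Proof.
move=> LD c0 cs x0 h0; pose i0 := Ordinal n0.
have D0 : 0 <= D by apply: le_trans (LD i0 i0); exact: normc_ge0.
have s1 : 1 <= s.
  have ci : 0 < normc (c i0 0) ^+ 2 by rewrite exprn_gt0// normc_gt0.
  rewrite -(ler_pM2r ci) mul1r (le_trans _ (cs i0))// lerXn2r//.
  - by rewrite nnegrE normc_ge0.
  - by rewrite nnegrE l2norm_ge0.
  - exact: normc_le_l2norm.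
have sim y : y != 0 -> _ := fun y0 => rayleigh_similarity
  (l2norm_mulmx_le V) (fun x => l2norm_le_inv x uV) AV y0 (fun j => LD j i0) D0.
pose y := invmx V *m x.
have xE : x = V *m y by rewrite mulKVmx.
have y0 : y != 0 by apply: contra_neq x0 => e; rewrite xE e mulmx0.
pose W := [set rayleigh (diag_mx L) (poly_col L c p) | p in
  [set p : {poly C} | (size p <= 6 * m + 1)%N /\ poly_col L c p != 0]].
(* Every diagonal Rayleigh quotient lies within [D] of [L 0 i0], whence the bound [D + D] for
   distances in [W]. *)
have [] := @dist_convex_le R W (rayleigh (diag_mx L) y) (D + D)
  (ln s / m%:R * D) h.
- have [p [sp p0 _]] := poly_col_direction 0 n0 m0 LD c0 cs.
  by exists (rayleigh (diag_mx L) (poly_col L c p)), p => //=; rewrite addn1.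
- by rewrite mulr_ge0// divr_ge0// ln_ge0.
- exact: h0.
- move=> _ _ [p /= [_ p0] <-] [q /= [_ q0] <-].
  have [_ hp] := sim _ p0; have [_ hq] := sim _ q0.
  exact: normcB_le hp hq.
- move=> _ _ t [p /= [sp p0] <-] [q /= [sq q0] <-] t01.
  have [a [b [ab0 abE]]] := rayleigh_convex (diag_mx L) p0 q0 t01.
  exists (a *: p + b *: q); last by rewrite poly_colD !poly_colZ.
  rewrite /= poly_colD !poly_colZ; split => //.
  apply: leq_trans (size_polyD _ _) _; rewrite geq_max.
  by rewrite !(leq_trans (size_scale_leq _ _)).
- move=> u; have [p [sp p0 pP]] := poly_col_direction u n0 m0 LD c0 cs.
  exists (rayleigh (diag_mx L) (poly_col L c p)).
    by exists p => //=; rewrite addn1.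
  set w := rayleigh _ (poly_col _ _ _) in pP *.
  have N0 : 0 < l2norm y ^+ 2 by rewrite exprn_gt0 ?l2norm_gt0.
  (* The quotient at [y] is a mean of the [L 0 j], so the bound valid for each eigenvalue passes to
     it. *)
  rewrite -opprB mulrN Re_N -(ler_pM2r N0) mulNr Re_rayleigh_diag//.
  rewrite -sumrN l2norm_sqr mulr_sumr; apply: ler_sum => j _.
  rewrite -mulrN -Re_N -mulrN opprB mulrC ler_wpM2r ?sqr_ge0//.
move=> _ [p [/= sp p0] <-] pP; exists p; split=> //.
have [h1 _] := sim _ y0; have [h2 _] := sim _ p0.
set wp := rayleigh _ (poly_col _ _ _) in pP h2; set wy := rayleigh _ y in pP h1.
rewrite xE; set rp := rayleigh A (V *m poly_col _ _ _) in h2 *.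
set ry := rayleigh A (V *m y) in h1 *.
apply: le_trans (normc_chain h1 pP h2) _.
rewrite /cond; move: (ln s / m%:R) (spectral_norm V * spectral_norm (invmx V)) => l k.
have -> : forall d e : R, (l + (k ^+ 2 - 1)) * d + e
  = (k ^+ 2 - 1) / 2 * d + (l * d + e) + (k ^+ 2 - 1) / 2 * d by move=> d e; field.
exact: lexx.
Qed.

(** With a single eigenvalue the previous estimate applies with [D = 0]. Otherwise there are exactly
    two coordinates, with distinct eigenvalues, and polynomials of degree at most one reach every
    vector. *)
Lemma rayleigh_krylov_exact (c x : 'cV[C]_n) (h : R) : (n <= 2)%N ->
  (forall j, c j 0 != 0) -> x != 0 -> 0 < h ->
  exists p : {poly C}, [/\ (size p <= 6 * m + 1)%N, poly_col L c p != 0 &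
    normc (rayleigh A x - rayleigh A (V *m poly_col L c p)) <= h].
Proof.
move=> n2 c0 x0 h0; have [Leq|] := pselect (forall i j, L 0 i = L 0 j).
  have [s cs] : exists s, forall j, l2norm c ^+ 2 <= s * normc (c j 0) ^+ 2.
    exists (\sum_i l2norm c ^+ 2 / normc (c i 0) ^+ 2) => j.
    have cj : 0 < normc (c j 0) ^+ 2 by rewrite exprn_gt0// normc_gt0.
    rewrite -ler_pdivrMr// (bigD1 j)//= lerDl sumr_ge0// => i _.
    by rewrite divr_ge0 ?sqr_ge0.
  have [|p [sp p0 pP]] := rayleigh_krylov_near (D := 0) _ c0 cs x0 h0.
    by move=> i j; rewrite (Leq i j) subrr normc0.
  by exists p; split => //; rewrite mulr0 add0r in pP.
move=> /existsNP[i /existsNP[j Lij]].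
have {}Lij : L 0 i - L 0 j != 0 by rewrite subr_eq0; apply/eqP.
have Lji : L 0 j - L 0 i != 0 by rewrite -opprB oppr_eq0.
have ij k : k = i \/ k = j.
  have : i != j by apply: contra_neq Lij => ->; rewrite subrr.
  rewrite -!val_eqE; case: i j k {Lij Lji} => i hi [j hj] [k hk] /= nij.
  have [/eqP|/eqP] : k == i \/ k == j by apply/orP; lia.
    by left; apply: val_inj.
  by right; apply: val_inj.
pose y := invmx V *m x.
have xE : x = V *m y by rewrite mulKVmx.
(* Lagrange interpolation of the values [y k 0 / c k 0] at the two eigenvalues. *)
pose p : {poly C} := (y i 0 / c i 0 / (L 0 i - L 0 j)) *: ('X - (L 0 j)%:P)
  + (y j 0 / c j 0 / (L 0 j - L 0 i)) *: ('X - (L 0 i)%:P).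
have pE : poly_col L c p = y.
  apply/colP => k; rewrite mxE /p !hornerE.
  have [->|->] := ij k; rewrite subrr ?mulr0 ?addr0 ?add0r.
    by rewrite divfK// divfK.
  by rewrite divfK// divfK.
exists p; rewrite pE -xE subrr normc0; split; last exact: ltW.
  apply: leq_trans (size_polyD _ _) _; rewrite geq_max.
  rewrite !(leq_trans (size_scale_leq _ _))// size_XsubC; lia.
by apply: contra_neq x0 => e; rewrite xE e mulmx0.
Qed.

(** Supplies a real number to compute with in place of the extended real [diam]: the largest
    distance between two eigenvalues. *)
Lemma diam_spectrum_ge : exists2 D, (forall i j, normc (L 0 i - L 0 j) <= D) &
  (D%:E <= diam (convex_hull (spectrum A)))%E.
Proof.
have [[i1 j1] _ P] := @arg_maxP _ _ _ (Ordinal n0, Ordinal n0) xpredT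
  (fun ij : 'I_n * 'I_n => normc (L 0 ij.1 - L 0 ij.2)) isT.
exists (normc (L 0 i1 - L 0 j1)) => [i j|]; first exact: (P (i, j)).
have Lhull i : convex_hull (spectrum A) (L 0 i).
  exists 1%N, (fun=> 1), (fun=> L 0 i); split => //.
  - by rewrite big_ord1.
  (* [eigenvalue] refers to row vectors, hence the rows of [invmx V]. *)
  - move=> _; apply/eigenvalueP; exists (row i (invmx V)).
      rewrite -row_mul (_ : invmx V *m A = diag_mx L *m invmx V).
        by apply/rowP => k; rewrite !mxE (bigD1 i)//= big1 ?addr0 => [|j ji];
          rewrite !mxE ?eqxx// eq_sym (negbTE ji) mulr0n mul0r.
      by rewrite -{1}(mulmxK uV A) AV !mulmxA mulVmx// mul1mx.
    apply/eqP => /(congr1 (mulmxr V)) /=; rewrite -row_mul mulVmx// mul0mx.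
    by move=> /rowP/(_ i); rewrite !mxE eqxx => /eqP; rewrite oner_eq0.
  - by rewrite big_ord1 mul1r.
by apply: ereal_sup_ubound; exists (L 0 i1), (L 0 j1).
Qed.

(** Both halves of the theorem end here, each with its own [s] and [e]. The comparison of [e] with
    [ln s / m%:R] is asked for [2 < n] only, as the approximation is exact up to [h] otherwise. *)
Lemma hausdorff_krylov_le (b : 'cV[C]_n) (Q : 'M[C]_(n, \dim (krylov A b (6 * m + 1))))
    (e D s : R) :
  (b != 0 -> orthonormal_basis (krylov A b (6 * m + 1)) Q) ->
  (forall i j, normc (L 0 i - L 0 j) <= D) ->
  (forall j, (invmx V *m b) j 0 != 0) ->
  (forall j, l2norm (invmx V *m b) ^+ 2 <= s * normc ((invmx V *m b) j 0) ^+ 2) ->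
  0 <= e -> ((2 < n)%N -> ln s / m%:R + (cond V ^+ 2 - 1) <= e) ->
  (hausdorff (numrange (compression A Q)) (numrange A) <= (e * D)%:E)%E.
Proof.
set c := invmx V *m b; move=> hQ LD c0 cs e0 he; have D0 : 0 <= D.
  by apply: le_trans (LD (Ordinal n0) (Ordinal n0)); exact: normc_ge0.
rewrite (krylov_numrange uV AV hQ) -/c numrangeE.
apply: hausdorff_le => [|_ [p /= [_ p0] <-]|_ [x /= x0 <-] h h0].
- exact: mulr_ge0.
- exists (V *m poly_col L c p) => //=; apply: contra_neq p0 => e00.
  by rewrite -(mulKmx uV (poly_col _ _ _)) e00 mulmx0.
have [n2|n2] := leqP n 2.
  have [p [sp p0 pP]] := rayleigh_krylov_exact n2 c0 x0 h0.
  exists (rayleigh A (V *m poly_col L c p)); first by exists p.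
  by rewrite (le_trans pP)// lerDr mulr_ge0.
have [p [sp p0 pP]] := rayleigh_krylov_near LD c0 cs x0 h0.
exists (rayleigh A (V *m poly_col L c p)); first by exists p.
by rewrite (le_trans pP)// lerD2r ler_wpM2r// he.
Qed.

End DeterministicBound.

(** * Numerical comparison for the first inequality *)

Section MinSquare.
Variable R : realType.
Local Notation C := R[i].

Lemma min_sqr_le n (c : 'cV[C]_n) j : min_sqr c <= normc (c j 0) ^+ 2.
Proof.
by apply: ge_inf; [exists 0 => _ [i _ <-]; exact: sqr_ge0|exists j].
Qed.

(** Eighth power of [1 + 1 / 8 <= expR (1 / 8)]. *)
Lemma expR1_ge : (5 / 2 : R) <= expR 1.
Proof.
have -> : (1 : R) = 8^-1 * 8%:R by rewrite mulVf.
rewrite expRM_natr; apply: (@le_trans _ _ ((1 + 8^-1) ^+ 8)); first by lra.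
apply: lerXn2r; rewrite ?nnegrE ?expR_ge0 ?addr_ge0//.
exact: expR_ge1Dx.
Qed.

(** Since [3 <= s], [X] is at least [5 / 12 * s] and at least [5 / 4], so [X ^+ 6] is at least
    [5 / 12 * s * (5 / 4) ^+ 5], which exceeds [s]; hence [ln s <= 6 * ln X]. The other terms
    compare by [k + 1 <= 4 * k]. *)
Lemma deterministic_rhs_ge (k M s : R) : 1 <= k -> 1 <= M -> 3 <= s ->
  ln s / M + (k ^+ 2 - 1)
  <= 6 * k ^+ 2 / M * ln (expR 1 * M * s / 6) + 4 * k * (k - 1).
Proof.
move=> k1 M1 s3; set X := expR 1 * M * s / 6.
have M0 : 0 < M by lra.
have s0 : 0 < s by lra.
have Xs : 5 / 12 * s <= X.
  rewrite /X; have := expR1_ge; move: (expR 1) => E E52.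
  have : 5 / 2 * 1 * s <= E * M * s by rewrite ler_pM2r// ler_pM//.
  lra.
have X1 : 5 / 4 <= X by lra.
have X0 : 0 < X by lra.
have lnX : 0 <= ln X by rewrite ln_ge0//; lra.
have sX : s <= X ^+ 6.
  have x5 : (5 / 4) ^+ 5 <= X ^+ 5 by apply: lerXn2r; rewrite ?nnegrE; lra.
  have : 5 / 12 * s * (5 / 4) ^+ 5 <= X * X ^+ 5.
    by apply: ler_pM => //; rewrite ?exprn_ge0; lra.
  rewrite -exprS; lra.
have ls : ln s <= 6 * ln X.
  rewrite mulrC mulr_natr -lnXn// ler_ln ?posrE// exprn_gt0//.
have : ln s / M <= 6 * k ^+ 2 / M * ln X.
  rewrite mulrAC ler_pM2r ?invr_gt0//; apply: le_trans ls _.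
  by rewrite -mulrA ler_wpM2l// ler_peMl// expr_ge1//; lra.
nra.
Qed.

End MinSquare.

(** * Continuity and Borel sets in complex coordinates *)

Section BorelSets.
Variable R : realType.
Variable n : nat.
Local Notation C := R[i].
Local Notation T := 'cV[R[i]^o]_n.

Lemma open_measurable_borelC (D : set T) : open D -> measurable (D : set (borelC R n)).
Proof. exact: sub_sigma_algebra. Qed.

(** Split into two real functions, so that facts about real-valued continuous functions apply. *)
Definition ccontinuous (F : T -> C) :=
  continuous (fun x => Re (F x) : R) /\ continuous (fun x => Im (F x) : R).

Lemma coord_near (x : T) (i : 'I_n) (e : R) : 0 < e ->
  \forall y \near x, normc ((x i 0 : C) - (y : T) i 0) < e.
Proof.
move=> e0; apply/nbhs_ballP; exists e%:C => /=; first by rewrite ltcR.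
by move=> y [_ /(_ i 0)]; rewrite /ball /= normc_def ltcR; case: (_ - _).
Qed.

Lemma ccontinuous_coord i : ccontinuous (fun x : T => x i 0 : C).
Proof.
split=> x; apply/(@cvgrPdist_lt _ _ _ (nbhs (x : T)) (nbhs_filter (x : T)))
    => e e0; have := coord_near x i e0;
  apply: (@filterS _ _ (nbhs_filter (x : T))) => y; apply: le_lt_trans.
  by rewrite -Re_N -Re_D; exact: normr_Re_le.
by rewrite -Im_N -Im_D; exact: normr_Im_le.
Qed.

Lemma ccontinuous_cst (z : C) : ccontinuous (fun=> z).
Proof. by split=> x; exact: cst_continuous. Qed.

Lemma ccontinuousD (F G : T -> C) :
  ccontinuous F -> ccontinuous G -> ccontinuous (fun x => F x + G x).
Proof.
move=> [Fr Fi] [Gr Gi]; split=> x; under eq_fun do rewrite ?Re_D ?Im_D.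
  by apply: continuousD; [exact: Fr|exact: Gr].
by apply: continuousD; [exact: Fi|exact: Gi].
Qed.

Lemma ccontinuousM (F G : T -> C) :
  ccontinuous F -> ccontinuous G -> ccontinuous (fun x => F x * G x).
Proof.
move=> [Fr Fi] [Gr Gi]; split.
  have -> : (fun x => Re (F x * G x)) = (fun x => Re (F x)) * (fun x => Re (G x))
      - (fun x => Im (F x)) * (fun x => Im (G x)).
    by apply/funext => x; rewrite Re_M.
  move=> x; apply: continuousB; apply: continuousM;
    by [exact: Fr|exact: Gr|exact: Fi|exact: Gi].
have -> : (fun x => Im (F x * G x)) = (fun x => Re (F x)) * (fun x => Im (G x))
    + (fun x => Im (F x)) * (fun x => Re (G x)).
  by apply/funext => x; rewrite Im_M.
move=> x; apply: continuousD; apply: continuousM;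
  by [exact: Fr|exact: Gr|exact: Fi|exact: Gi].
Qed.

Lemma ccontinuousJ (F : T -> C) :
  ccontinuous F -> ccontinuous (fun x => conjc (F x)).
Proof.
move=> [Fr Fi]; split=> x; under eq_fun do rewrite ?Re_J ?Im_J; first exact: Fr.
by apply: continuousN; exact: Fi.
Qed.

Lemma ccontinuous_sum (I : Type) (r : seq I) (F : I -> T -> C) :
  (forall i, ccontinuous (F i)) -> ccontinuous (fun x => \sum_(i <- r) F i x).
Proof.
move=> Fc; elim: r => [|i r IH].
  by under eq_fun do rewrite big_nil; exact: ccontinuous_cst.
by under eq_fun do rewrite big_cons; exact: ccontinuousD.
Qed.

Lemma ccontinuous_mulmx k (M : 'M[C]_(k, n)) i :
  ccontinuous (fun x : T => (M *m (x : 'cV[C]_n)) i 0).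
Proof.
under eq_fun do rewrite mxE; apply: ccontinuous_sum => j.
by apply: ccontinuousM; [exact: ccontinuous_cst|exact: ccontinuous_coord].
Qed.

Lemma ccontinuous_dotv (M N : 'M[C]_n) :
  ccontinuous (fun x : T => dotv (M *m (x : 'cV[C]_n)) (N *m (x : 'cV[C]_n))).
Proof.
under eq_fun do rewrite dotvE; apply: ccontinuous_sum => j.
by apply: ccontinuousM; [apply: ccontinuousJ|]; exact: ccontinuous_mulmx.
Qed.

Lemma continuous_normc_sqr (F : T -> C) :
  ccontinuous F -> continuous (fun x => normc (F x) ^+ 2 : R).
Proof.
move=> [Fr Fi].
have -> : (fun x => normc (F x) ^+ 2) = (fun x => Re (F x)) * (fun x => Re (F x))
    + (fun x => Im (F x)) * (fun x => Im (F x)).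
  by apply/funext => x; rewrite normc_sqr !expr2.
by move=> x; apply: continuousD; apply: continuousM; by [exact: Fr|exact: Fi].
Qed.

Lemma open_lt_continuous (f g : T -> R) :
  continuous f -> continuous g -> open [set x | f x < g x].
Proof.
move=> fc gc; have -> : [set x | f x < g x] = (g - f) @^-1` [set r | 0 < r].
  by apply/seteqP; split => x /=; rewrite subr_gt0.
apply: open_comp; last exact: open_gt.
by move=> x _; apply: continuousB; [exact: gc|exact: fc].
Qed.

(** For [0 < t], clearing the denominator gives a strict inequality between continuous functions of
    [x]. Where [M *m x] vanishes it reads [0 < 0], which accounts for the first conjunct. *)
Lemma open_rayleigh_near (A M : 'M[C]_n) (y : C) (t : R) :
  open [set x : T | M *m (x : 'cV[C]_n) != 0 /\
    normc (y - rayleigh A (M *m (x : 'cV[C]_n))) < t].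
Proof.
have [t0|t0] := leP t 0.
  have -> : [set x : T | M *m (x : 'cV[C]_n) != 0 /\
    normc (y - rayleigh A (M *m (x : 'cV[C]_n))) < t] = set0.
    apply/seteqP; split => x //= [_ h].
    by have := lt_le_trans h t0; rewrite ltNge normc_ge0.
  exact: open0.
have -> : [set x : T | M *m (x : 'cV[C]_n) != 0 /\
      normc (y - rayleigh A (M *m (x : 'cV[C]_n))) < t]
    = [set x : T |
      normc (dotv (M *m (x : 'cV[C]_n)) (((y%:M - A) *m M) *m (x : 'cV[C]_n))) ^+ 2
      < normc (t%:C * dotv (M *m (x : 'cV[C]_n)) (M *m (x : 'cV[C]_n))) ^+ 2].
  apply/seteqP; split => x /=; rewrite -mulmxA; set z := M *m _.
    move=> [z0 h]; have N0 : 0 < normc (dotv z z) by rewrite normc_gt0 dotvv_neq0.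
    rewrite ltr_sqr ?nnegrE ?normc_ge0// normcM normc_real (gtr0_norm t0).
    rewrite -ltr_pdivrMr// -normcV -normcM; apply: le_lt_trans h.
    rewrite mulmxBl dotvBr mul_scalar_mx dotvZr mulrBl mulfK// dotvv_neq0//.
  have [->|z0] := eqVneq z 0; first by rewrite mulmx0 /dotv mulmx0 mxE mulr0 ltxx.
  have N0 : 0 < normc (dotv z z) by rewrite normc_gt0 dotvv_neq0.
  rewrite ltr_sqr ?nnegrE ?normc_ge0// normcM normc_real (gtr0_norm t0).
  rewrite -ltr_pdivrMr// -normcV -normcM => h; split => //; apply: le_lt_trans h.
  rewrite mulmxBl dotvBr mul_scalar_mx dotvZr mulrBl mulfK// dotvv_neq0//.
apply: open_lt_continuous; apply: continuous_normc_sqr.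
  exact: ccontinuous_dotv.
by apply: ccontinuousM; [exact: ccontinuous_cst|exact: ccontinuous_dotv].
Qed.

End BorelSets.

(** * Separability of subsets of the plane *)

Section DenseSequence.
Variable R : realType.
Local Notation C := R[i].

(** One point of [Y] is picked in each square around a rational point, and [y0] for the squares that
    miss [Y]. *)
Lemma dense_sequence (Y : set C) : Y !=set0 ->
  exists y : nat -> C, (forall k, Y (y k)) /\
    forall z (e : R), Y z -> 0 < e -> exists k, normc (z - y k) < e.
Proof.
move=> [y0 Yy0].
pose cell (qk : rat * rat * nat) : set C := [set z | [/\ Y z,
  `|Re z - ratr qk.1.1| < qk.2.+1%:R^-1 & `|Im z - ratr qk.1.2| < qk.2.+1%:R^-1]].
pose y k : C := if @unpickle (rat * rat * nat)%type k is Some qk then xget y0 (cell qk) else y0.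
exists y; split=> [k|z e Yz e0].
  rewrite /y; case: unpickle => // qk; case: xgetP => [_ -> []|] //.
(* Two points of one cell differ by less than [2 / k.+1%:R] in each of the two coordinates, hence by
   less than [4 / k.+1%:R]. *)
pose k := Num.trunc (4 / e).
have ke : 4 / k.+1%:R < e.
  by rewrite ltr_pdivrMr// -ltr_pdivrMl// mulrC truncnS_gt.
have k0 : 0 < (k.+1%:R^-1 : R) by rewrite invr_gt0.
have approx (r : R) : exists q : rat, `|r - ratr q| < k.+1%:R^-1.
  have /rat_in_itvoo[q] : r < r + k.+1%:R^-1 by rewrite ltrDl.
  rewrite in_itv /= => /andP[rq qr]; exists q.
  by rewrite distrC ger0_norm ?subr_ge0 ?ltW// ltrBlDl.
have [q1 h1] := approx (Re z); have [q2 h2] := approx (Im z).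
exists (pickle (q1, q2, k)); rewrite /y pickleK.
case: xgetP => [w _ [_ /= w1 w2]|none]; last by case: (none z).
apply: le_lt_trans (normc_le_ReIm _) _; apply: lt_trans ke.
rewrite Re_D Im_D Re_N Im_N.
have -> : Re z - Re w = (Re z - ratr q1) - (Re w - ratr q1) by ring.
have -> : Im z - Im w = (Im z - ratr q2) - (Im w - ratr q2) by ring.
apply: le_lt_trans (lerD (ler_normB _ _) (ler_normB _ _)) _.
move: h1 h2 w1 w2; move: `|Re z - _| `|Im z - _| `|Re w - _| `|Im w - _| (k.+1%:R^-1).
by move=> a b c d v; lra.
Qed.

End DenseSequence.

(** * The Hausdorff bound as countably many strict conditions *)

Section HausdorffCountable.
Variable R : realType.
Local Notation C := R[i].
Implicit Types (X Y : set C).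

Lemma hausdorff_ge0 X Y : Y !=set0 -> (0 <= hausdorff X Y)%E.
Proof.
move=> [y Yy]; rewrite /hausdorff le_max; apply/orP; right.
apply: (@le_trans _ _ (dist_to X y)); last by apply: ereal_sup_ubound; exists y.
by apply: le_ereal_inf_tmp => _ [x _ <-]; rewrite lee_fin normc_ge0.
Qed.

(** Strict inequalities with a slack are used because they become open conditions on a vector on
    which [X] depends. *)
Lemma hausdorff_le_countable X Y (y : nat -> C) (e : R) : X `<=` Y ->
  (forall k, Y (y k)) ->
  (forall z (h : R), Y z -> 0 < h -> exists k, normc (z - y k) < h) ->
  ((hausdorff X Y <= e%:E)%E <->
   forall j k : nat, exists2 x, X x & normc (y j - x) < e + k.+1%:R^-1).
Proof.
move=> XY Yy dense; split=> [le j k|near].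
  have : (dist_to X (y j) < (e + k.+1%:R^-1)%:E)%E.
    apply: (@le_lt_trans _ _ (hausdorff X Y)).
      by rewrite le_max; apply/orP; right; apply: ereal_sup_ubound; exists (y j).
    by apply: le_lt_trans le _; rewrite lte_fin ltrDl invr_gt0.
  by move=> /ereal_inf_lt[_ [x Xx <-]]; rewrite lte_fin => h; exists x.
have small (h : R) : 0 < h -> exists k : nat, k.+1%:R^-1 < h.
  move=> h0; exists (Num.trunc h^-1).
  by rewrite invf_plt ?posrE ?truncnS_gt.
apply: hausdorff_le => //.
  (* For negative [e] some slack would leave [normc] below a negative number. *)
  rewrite leNgt; apply/negP => e0.
  have [k hk] : exists k : nat, k.+1%:R^-1 < - e by apply: small; rewrite oppr_gt0.
  have [x _] := near 0%N k; apply/negP; rewrite -leNgt.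
  by apply: le_trans (normc_ge0 _); rewrite -lerBrDl sub0r ltW.
move=> z Yz h h0; have h2 : 0 < h / 2 by rewrite divr_gt0.
have [j zj] := dense z _ Yz h2; have [k hk] := small _ h2.
have [x Xx jx] := near j k; exists x => //.
rewrite -(subrK (y j) z) -addrA (le_trans (le_normcD _ _))//.
apply: (@le_trans _ _ (h / 2 + (e + h / 2))).
  by rewrite lerD// ?(ltW zj)// (le_trans (ltW jx))// lerD2l ltW.
by rewrite addrCA -splitr.
Qed.

End HausdorffCountable.

(** * Measurability of the event *)

Section EventMeasurable.
Variable R : realType.
Local Notation C := R[i].
Variables (k n : nat) (A V : 'M[C]_n) (L : 'rV[C]_n).
Hypotheses (n0 : (0 < n)%N) (uV : V \in unitmx) (AV : A *m V = V *m diag_mx L).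
Variable Q : forall b : 'cV[C]_n, 'M[C]_(n, \dim (krylov A b k)).
Hypothesis hQ : forall b, b != 0 -> orthonormal_basis (krylov A b k) (Q b).

(** By [krylov_numrange] the event involves [b] only through the vectors [M p *m b]. For given [j]
    and [l] it is a union of open sets over all [p], and such a union is open even though it is
    uncountable. *)
Lemma measurable_hausdorff_le (e : \bar R) :
  measurable ([set b | (hausdorff (numrange (compression A (Q b))) (numrange A)
    <= e)%E] : set (borelC R n)).
Proof.
have A0 : numrange A !=set0.
  rewrite numrangeE; exists (rayleigh A (delta_mx (Ordinal n0) 0)).
  exists (delta_mx (Ordinal n0) 0) => //=.
  by rewrite -l2norm_gt0 l2norm_delta.
case: e => [e||]; last 2 first.
- rewrite (_ : [set b | _] = setT); first exact: measurableT.
  by apply/seteqP; split => b //= _; rewrite leey.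
- rewrite (_ : [set b | _] = set0); first exact: measurable0.
  apply/seteqP; split => b //= h.
  by have := le_trans (hausdorff_ge0 (numrange (compression A (Q b))) A0) h.
have [y [Yy dense]] := dense_sequence A0.
(* The matrix p(A), which does not depend on [b]. *)
pose M (p : {poly C}) := V *m diag_mx (\row_j p.[L 0 j]) *m invmx V.
have ME p (b : 'cV[C]_n) : V *m poly_col L (invmx V *m b) p = M p *m b.
  rewrite /M -!mulmxA; congr (V *m _); apply/colP => j.
  by rewrite mul_diag_mx !mxE.
have V0 x : (V *m x != 0) = (x != 0).
  congr (~~ _); apply/eqP/eqP => [e0|->]; last by rewrite mulmx0.
  by rewrite -(mulKmx uV x) e0 mulmx0.
pose F j l := \bigcup_(p in [set p : {poly C} | (size p <= k)%N])
  [set b : 'cV[R[i]^o]_n | M p *m (b : 'cV[C]_n) != 0 /\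
    normc (y j - rayleigh A (M p *m (b : 'cV[C]_n))) < e + l.+1%:R^-1].
rewrite (_ : [set b | _] = \bigcap_j \bigcap_l F j l).
  apply: bigcapT_measurable => j; apply: bigcapT_measurable => l.
  apply: open_measurable_borelC; apply: bigcup_open => p _.
  exact: open_rayleigh_near.
have sub (b : 'cV[C]_n) : numrange (compression A (Q b)) `<=` numrange A.
  rewrite (krylov_numrange uV AV (@hQ b)) numrangeE => _ [p /= [_ p0] <-].
  by exists (V *m poly_col L (invmx V *m b) p) => //=; rewrite V0.
apply/seteqP; split => b /=.
  move=> /(hausdorff_le_countable e (@sub b) Yy dense) h j _ l _.
  have [z + hx] := h j l; rewrite (krylov_numrange uV AV (@hQ b)).
  move=> [p /= [pk p0] xE]; exists p => //=.
  by rewrite -ME V0 xE.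
move=> h; apply/(hausdorff_le_countable e (@sub b) Yy dense) => j l.
have [p /= pk [p0 pn]] := h j I l I; exists (rayleigh A (M p *m b)) => //.
rewrite (krylov_numrange uV AV (@hQ b)); exists p; rewrite ?ME//=.
by split => //; rewrite -V0 ME.
Qed.

End EventMeasurable.

(** * Householder reflections *)

Section Householder.
Variable R : realType.
Variable n : nat.
Local Notation C := R[i].
Implicit Types (u v x : 'cV[C]_n).

Definition householder v : 'M[C]_n :=
  1%:M - (2 / dotv v v) *: (v *m v^t*).

Lemma householderE v x :
  householder v *m x = x - (2 * dotv v x / dotv v v) *: v.
Proof.
rewrite mulmxBl mul1mx -scalemxAl -mulmxA; congr (_ - _).
have -> : v^t* *m x = (dotv v x)%:M by apply/matrixP => i j; rewrite !ord1 [RHS]mxE.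
by rewrite mul_mx_scalar scalerA mulrAC.
Qed.

Lemma householder_unitary v : v != 0 -> householder v \is unitarymx.
Proof.
move=> v0; apply/unitarymxP.
have d0 := dotvv_neq0 v0.
have -> : (householder v)^t* = householder v.
  have cd : conjc (2 / dotv v v) = 2 / dotv v v.
    by rewrite dotvv -(rmorph_nat (real_complex R)) -fmorphV -rmorphM conjc_real.
  rewrite /householder linearB /= map_mxB trmx1 map_mx1; congr (_ - _).
  rewrite linearZ /= map_mxZ trmx_mul map_mxM map_trmx trmxK.
  congr (_ *: _); first exact: cd.
  by congr (_ *m _); apply/matrixP => i j; rewrite !mxE; exact: conjcK.
apply/matrixP => k l.
have E (M : 'M[C]_n) : M k l = (M *m (delta_mx l 0 : 'cV[C]_n)) k 0.
  by rewrite -colE mxE.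
rewrite [LHS]E [RHS]E.
have -> : householder v *m householder v *m (delta_mx l 0 : 'cV[C]_n) = delta_mx l 0.
  rewrite -mulmxA !householderE; set x := delta_mx l 0.
  have -> : dotv v (x - (2 * dotv v x / dotv v v) *: v) = - dotv v x.
    by rewrite dotvBr dotvZr divfK//; ring.
  by rewrite mulrN mulNr scaleNr opprK subrK.
by rewrite mul1mx.
Qed.

Lemma unitary_l2norm (U : 'M[C]_n) x : U \is unitarymx -> l2norm (U *m x) = l2norm x.
Proof.
move=> Uu; apply/eqP; rewrite -(@eqrXn2 _ 2) ?l2norm_ge0//; apply/eqP.
apply: (@complexI R); rewrite -!dotvv dotv_mulmx mulmxA.
by move: Uu; rewrite -trmxC_unitary => /unitarymxP; rewrite trmxCK => ->; rewrite mul1mx.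
Qed.

(** A phase [a] makes entry [i0] of [w = a *: u] equal to a real number [r]. Then
    [dotv v v = (1 - r%:C) * 2], and the reflection along [v] turns the coordinate [i0] into
    [dotv w]. *)
Lemma unitary_first_row (i0 : 'I_n) u : l2norm u = 1 ->
  exists2 U : 'M[C]_n, U \is unitarymx &
    forall x, normc ((U *m x) i0 0) = normc (dotv u x).
Proof.
move=> u1.
have [a a1 [r aE]] : exists2 a : C, normc a = 1 & exists r : R, a * u i0 0 = r%:C.
  have [e|e] := eqVneq (u i0 0) 0.
    by exists 1; rewrite ?normc1//; exists 0; rewrite e mulr0.
  exists (conjc (u i0 0) / (normc (u i0 0))%:C).
    rewrite normcM normcJ normcV normc_real ger0_norm ?normc_ge0// divff//.
    by rewrite normc_eq0.
  exists (normc (u i0 0)); rewrite mulrAC mulJc.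
  by rewrite -fmorphV -rmorphM expr2 mulfK// normc_eq0.
pose w := a *: u; pose v := w - delta_mx i0 0.
have w1 : dotv w w = 1.
  by rewrite dotvv l2normZ a1 u1 mul1r expr1n.
have wx x : normc (dotv w x) = normc (dotv u x).
  by rewrite dotvZl normcM normcJ a1 mul1r.
have wi : w i0 0 = r%:C by rewrite mxE.
have vx x : dotv v x = dotv w x - x i0 0.
  by rewrite /v dotvC dotvBr rmorphB /= -!dotvC dotv_delta.
have [v0|v0] := eqVneq v 0.
  exists 1%:M => [|x]; first by apply/unitarymxP; rewrite trmx1 map_mx1 mulmx1.
  rewrite mul1mx -wx; congr normc; apply/eqP; rewrite eq_sym -subr_eq0 -vx v0.
  by rewrite dotvC /dotv mulmx0 mxE conjc0.
exists (householder v) => [|x]; first exact: householder_unitary.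
rewrite -wx householderE; congr normc.
have vi : v i0 0 = r%:C - 1 by rewrite [LHS]mxE wi 2!mxE !eqxx.
have vv : dotv v v = (1 - r%:C) * 2.
  have wd : dotv w (delta_mx i0 0) = r%:C.
    by rewrite dotvC dotv_delta wi; exact: conjc_real.
  rewrite vx vi [in dotv w v]/v dotvBr w1 wd.
  by ring.
have r1 : 1 - r%:C != 0 :> C.
  by apply: contra_neq (dotvv_neq0 v0); rewrite vv => ->; rewrite mul0r.
rewrite 3!mxE vi vv vx; field; exact: r1.
Qed.

End Householder.

(** * Anti-concentration on the sphere *)

Section AntiConcentration.
Variable R : realType.
Variable n : nat.
Local Notation C := R[i].
Local Notation T := 'cV[R[i]^o]_n.
Implicit Types (M : 'M[C]_n) (x u : 'cV[C]_n).

Lemma continuous_bigsum (I : Type) (r : seq I) (P : pred I) (F : I -> T -> R) :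
  (forall i, continuous (F i)) -> continuous (fun x : T => \sum_(i <- r | P i) F i x).
Proof.
move=> Fc; elim: r => [|i r IH].
  by under eq_fun do rewrite big_nil; move=> x; exact: cst_continuous.
under eq_fun do rewrite big_cons; case: (P i) => // x.
by apply: cvgD; [exact: (nbhs_filter (x : T))|exact: Fc|exact: IH].
Qed.

Lemma continuous_sum_normc_sqr M (P : pred 'I_n) :
  continuous (fun x : T => \sum_(i | P i) normc ((M *m (x : 'cV[C]_n)) i 0) ^+ 2 : R).
Proof.
apply: continuous_bigsum => i; apply: continuous_normc_sqr.
exact: ccontinuous_mulmx.
Qed.

Lemma measurable_sum_normc_le M (P : pred 'I_n) (r : R) :
  measurable ([set x | \sum_(i | P i) normc ((M *m (x : 'cV[C]_n)) i 0) ^+ 2 <= r]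
    : set (borelC R n)).
Proof.
rewrite (_ : [set x | _] = ~` [set x : T |
    r < \sum_(i | P i) normc ((M *m (x : 'cV[C]_n)) i 0) ^+ 2]).
  apply: measurableC; apply: open_measurable_borelC.
  apply: open_lt_continuous; last exact: continuous_sum_normc_sqr.
  by move=> x; exact: cst_continuous.
by apply/seteqP; split => x /=; rewrite leNgt => /negP.
Qed.

Lemma measurable_normc_lt M i (r : R) :
  measurable ([set x | normc ((M *m (x : 'cV[C]_n)) i 0) ^+ 2 < r] : set (borelC R n)).
Proof.
apply: open_measurable_borelC; apply: open_lt_continuous.
  by apply: continuous_normc_sqr; exact: ccontinuous_mulmx.
by move=> x; exact: cst_continuous.
Qed.

Lemma measurable_sphere M :
  measurable ([set x | l2norm (M *m (x : 'cV[C]_n)) = 1] : set (borelC R n)).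
Proof.
rewrite (_ : [set x | _] =
  [set x : T | \sum_i normc ((M *m (x : 'cV[C]_n)) i 0) ^+ 2 <= 1] `&`
  ~` [set x : T | \sum_i normc ((M *m (x : 'cV[C]_n)) i 0) ^+ 2 < 1]).
  apply: measurableI; first exact: (@measurable_sum_normc_le M xpredT).
  apply: measurableC; apply: open_measurable_borelC; apply: open_lt_continuous.
    exact: (@continuous_sum_normc_sqr M xpredT).
  by move=> x; exact: cst_continuous.
apply/seteqP; split => x /=; rewrite -l2norm_sqr; first by move=> ->; rewrite expr1n ltxx.
move=> [le1 /negP]; rewrite -leNgt => ge1.
have : l2norm (M *m (x : 'cV[C]_n)) ^+ 2 == 1 by rewrite eq_le le1.
by rewrite sqrp_eq1 ?l2norm_ge0// => /eqP.
Qed.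

Variable i0 : 'I_n.

(** For [j != i0] the last condition says that the coordinates [i0] and [j] carry mass at least
    [1 / n]; phrased through the other coordinates, it is preserved by reflections of that plane. *)
Definition thin_slab j (t : R) : set 'cV[C]_n :=
  [set x | [/\ l2norm x = 1, normc (x i0 0) ^+ 2 < t &
    \sum_(i | (i != i0) && (i != j)) normc (x i 0) ^+ 2 <= 1 - n%:R^-1]].

Lemma measurable_thin_slab M j t :
  measurable ([set x | thin_slab j t (M *m (x : 'cV[C]_n))] : set (borelC R n)).
Proof.
rewrite (_ : [set x | _] = [set x | l2norm (M *m (x : 'cV[C]_n)) = 1] `&`
  ([set x | normc ((M *m (x : 'cV[C]_n)) i0 0) ^+ 2 < t] `&`
   [set x | \sum_(i | (i != i0) && (i != j)) normc ((M *m (x : 'cV[C]_n)) i 0) ^+ 2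
     <= 1 - n%:R^-1])).
  apply: measurableI; first exact: measurable_sphere.
  by apply: measurableI; [exact: measurable_normc_lt|exact: measurable_sum_normc_le].
by apply/seteqP; split => [x [h1 h2 h3]|x [h1 [h2 h3]]]; do ?split.
Qed.

(* Reflections of the plane of coordinates i0 and j turn the i0-coordinate
   through pairwise transverse directions, so slabs they move are disjoint. *)
Definition plane_vec j (y : R) : 'cV[C]_n :=
  y%:C *: delta_mx i0 0 - delta_mx j 0.

(** With [y = tan (theta / 2)] the new coordinate is [cos theta * x i0 0 + sin theta * x j 0]; the
    factor [1 + y ^+ 2] clears the denominator. *)
Lemma plane_vec_reflect j y x : j != i0 ->
  let z := householder (plane_vec j y) *m x in
  (1 + y ^+ 2)%:C * z i0 0 = (1 - y ^+ 2)%:C * x i0 0 + (2 * y)%:C * x j 0 /\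
  forall i, i != i0 -> i != j -> z i 0 = x i 0.
Proof.
move=> ji z; have i0j : (i0 == j) = false by rewrite eq_sym (negbTE ji).
have vE i : plane_vec j y i 0 = y%:C * (i == i0)%:R - (i == j)%:R.
  by rewrite !mxE eqxx !andbT.
have vx w : dotv (plane_vec j y) w = y%:C * w i0 0 - w j 0.
  rewrite dotvC dotvBr dotvZr rmorphB rmorphM /= -!dotvC !dotv_delta.
  by congr (_ * _ - _); exact: conjc_real.
have vv : dotv (plane_vec j y) (plane_vec j y) = (1 + y ^+ 2)%:C.
  rewrite vx !vE !eqxx i0j (negbTE ji) rmorphD rmorphXn rmorph1 /=; ring.
have d0 : (1 + y ^+ 2)%:C != 0 :> C.
  by apply/eqP => -[] /eqP; rewrite gt_eqF// ltr_pwDl// sqr_ge0.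
have zE i : z i 0 = x i 0 - 2 * (y%:C * x i0 0 - x j 0) / (1 + y ^+ 2)%:C
    * (y%:C * (i == i0)%:R - (i == j)%:R).
  by rewrite /z householderE vx vv 3!mxE vE.
split=> [|i /negbTE ii0 /negbTE ij].
  rewrite zE eqxx i0j mulr1 subr0 mulrBr mulrCA !mulrA mulfVK//.
  have -> : (2 * y)%:C = 2 * y%:C :> C by rewrite rmorphM /= rmorph_nat.
  have -> : (1 + y ^+ 2)%:C = 1 + y%:C ^+ 2 :> C by rewrite rmorphD /= rmorphXn.
  have -> : (1 - y ^+ 2)%:C = 1 - y%:C ^+ 2 :> C by rewrite rmorphB /= rmorphXn.
  by ring.
by rewrite zE ii0 ij mulr0 subr0 mulr0 subr0.
Qed.

Lemma plane_vec_neq0 j y : j != i0 -> plane_vec j y != 0.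
Proof.
move=> ji; apply/eqP => /matrixP/(_ j 0); rewrite !mxE !eqxx (negbTE ji) /=.
by rewrite mulr0 sub0r => /eqP; rewrite oppr_eq0 oner_eq0.
Qed.

(** The two linear forms in [x0] and [x1] have determinant [2 * (y - z) * (1 + y * z)] up to sign,
    so if both are small, [x0] and [x1] are small. *)
Lemma slab_transverse (x0 x1 : C) (y z t : R) : 0 <= y <= 1 -> 0 <= z <= 1 ->
  normc ((1 - y ^+ 2)%:C * x0 + (2 * y)%:C * x1) ^+ 2 < 4 * t ->
  normc ((1 - z ^+ 2)%:C * x0 + (2 * z)%:C * x1) ^+ 2 < 4 * t ->
  (y - z) ^+ 2 * (normc x0 ^+ 2 + normc x1 ^+ 2) < 20 * t.
Proof.
rewrite !normc_sqr; case: x0 x1 => [a b] [c d] /=.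
rewrite !mul0r !subr0 !addr0.
pose p y a c := (1 - y ^+ 2) * a + 2 * y * c : R.
rewrite -!/(p _ _ _).
move=> /andP[y0 y1] /andP[z0 z1] hy hz.
have one_sub (v : R) : 0 <= v <= 1 -> 0 <= 1 - v ^+ 2 <= 1.
  by move=> /andP[v0 v1]; rewrite subr_ge0 expr_le1// v1 gerBl sqr_ge0.
(* Cramer's rule: the first unknown contributes [2] and the second [1 / 2]. With two forms below
   [4 * t], the constant [5 / 2] yields [20 * t]. *)
have real_part (a1 c1 : R) : (y - z) ^+ 2 * (a1 ^+ 2 + c1 ^+ 2)
    <= 5 / 2 * (p y a1 c1 ^+ 2 + p z a1 c1 ^+ 2).
  have e1 : 2 * (y - z) * (1 + y * z) * a1 = 2 * y * p z a1 c1 - 2 * z * p y a1 c1.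
    by rewrite /p; ring.
  have e2 : 2 * (y - z) * (1 + y * z) * c1
      = (1 - z ^+ 2) * p y a1 c1 - (1 - y ^+ 2) * p z a1 c1.
    by rewrite /p; ring.
  have yz : 1 <= (1 + y * z) ^+ 2.
    by have := mulr_ge0 y0 z0; nra.
  have sq (g h q r : R) : 0 <= g <= 1 -> 0 <= h <= 1 ->
      (g * q - h * r) ^+ 2 <= 2 * (q ^+ 2 + r ^+ 2).
    move=> /andP[g0 g1] /andP[h0 h1].
    have gq : (g * q) ^+ 2 <= q ^+ 2.
      by rewrite exprMn ler_piMl ?sqr_ge0// expr_le1.
    have hr : (h * r) ^+ 2 <= r ^+ 2.
      by rewrite exprMn ler_piMl ?sqr_ge0// expr_le1.
    have := sqr_ge0 (g * q + h * r).
    by move: gq hr; rewrite sqrrB sqrrD; move: (g * q) (h * r) => ? ?; lra.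
  have s1 : ((y - z) * (1 + y * z) * a1) ^+ 2 <= 2 * (p z a1 c1 ^+ 2 + p y a1 c1 ^+ 2).
    have -> : (y - z) * (1 + y * z) * a1 = y * p z a1 c1 - z * p y a1 c1 by lra.
    by apply: sq; apply/andP.
  have s2 : (2 * ((y - z) * (1 + y * z) * c1)) ^+ 2 <= 2 * (p y a1 c1 ^+ 2 + p z a1 c1 ^+ 2).
    have -> : 2 * ((y - z) * (1 + y * z) * c1)
      = (1 - z ^+ 2) * p y a1 c1 - (1 - y ^+ 2) * p z a1 c1 by lra.
    by apply: sq; apply: one_sub; apply/andP.
  have : (y - z) ^+ 2 * (a1 ^+ 2 + c1 ^+ 2)
      <= ((y - z) * (1 + y * z) * a1) ^+ 2 + ((y - z) * (1 + y * z) * c1) ^+ 2.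
    have : 0 <= (y - z) ^+ 2 * (a1 ^+ 2 + c1 ^+ 2) * ((1 + y * z) ^+ 2 - 1).
      apply: mulr_ge0; last by rewrite subr_ge0.
      by apply: mulr_ge0; [exact: sqr_ge0|apply: addr_ge0; exact: sqr_ge0].
    by rewrite !exprMn; move: ((1 + _) ^+ 2) ((y - z) ^+ 2) => W W'; lra.
  by move: s1 s2; rewrite (exprMn 2); lra.
have := real_part a c; have := real_part b d.
move: hy hz; rewrite !mulrDr; lra.
Qed.

Lemma plane_reflection j y : j != i0 -> exists2 U : 'M[C]_n, U \is unitarymx &
  forall x, (1 + y ^+ 2)%:C * (U *m x) i0 0
      = (1 - y ^+ 2)%:C * x i0 0 + (2 * y)%:C * x j 0 /\
    forall i, i != i0 -> i != j -> (U *m x) i 0 = x i 0.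
Proof.
move=> ji; exists (householder (plane_vec j y)) => [|x].
  exact/householder_unitary/plane_vec_neq0.
exact: plane_vec_reflect.
Qed.

(** The factor [1 + r ^+ 2 <= 2] turns [t] into [4 * t], and the plane carries mass at least
    [1 / n]; [slab_transverse] would then give [(y - z) ^+ 2 / n < 20 * t]. *)
Lemma reflected_slabs_disjoint j (t y z : R) x (Y Z : 'cV[C]_n) : (0 < n)%N ->
  j != i0 -> l2norm x = 1 ->
  0 <= y <= 1 -> 0 <= z <= 1 -> 20 * n%:R * t <= (y - z) ^+ 2 ->
  (1 + y ^+ 2)%:C * Y i0 0 = (1 - y ^+ 2)%:C * x i0 0 + (2 * y)%:C * x j 0 ->
  (1 + z ^+ 2)%:C * Z i0 0 = (1 - z ^+ 2)%:C * x i0 0 + (2 * z)%:C * x j 0 ->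
  (forall i, i != i0 -> i != j -> Y i 0 = x i 0) ->
  thin_slab j t Y -> thin_slab j t Z -> False.
Proof.
move=> n0 ji x1 y01 z01 tyz ey ez oy [_ yt ys] [_ zt _].
have bound (r : R) (a : C) : 0 <= r <= 1 -> normc a ^+ 2 < t ->
    normc ((1 + r ^+ 2)%:C * a) ^+ 2 < 4 * t.
  move=> /andP[r0 r1] lt; rewrite normcM exprMn normc_real real_normK ?num_real//.
  apply: (@le_lt_trans _ _ (4 * normc a ^+ 2)); last by rewrite ltr_pM2l.
  rewrite ler_wpM2r ?sqr_ge0//.
  have : r ^+ 2 <= 1 by rewrite expr_le1.
  by have := sqr_ge0 r; move: (r ^+ 2) => w w0 w1; nra.
have hy := bound _ _ y01 yt; have hz := bound _ _ z01 zt.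
rewrite ey in hy; rewrite ez in hz.
have := slab_transverse y01 z01 hy hz; apply/negP; rewrite -leNgt.
have others : \sum_(i | (i != i0) && (i != j)) normc (x i 0) ^+ 2 <= 1 - n%:R^-1.
  rewrite (le_trans _ ys)// ler_sum// => i /andP[i1 i2].
  by rewrite oy.
have big : n%:R^-1 <= normc (x i0 0) ^+ 2 + normc (x j 0) ^+ 2.
  have : l2norm x ^+ 2 = 1 by rewrite x1 expr1n.
  by rewrite l2norm_sqr (bigD1 i0)//= (bigD1 j)//=; move: others; lra.
have nR : 0 < n%:R^-1 :> R by rewrite invr_gt0 ltr0n.
have -> : 20 * t = 20 * n%:R * t * n%:R^-1.
  by field; rewrite pnatr_eq0 -lt0n.
apply: (@le_trans _ _ ((y - z) ^+ 2 * n%:R^-1)); first by rewrite ler_wpM2r// ltW.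
by rewrite ler_wpM2l ?sqr_ge0.
Qed.

Variable mu : probability (borelC R n) R.
Hypothesis mu_uniform : uniform_sphere mu.

(** The parameters [k / N] with [k < N] are at least [1 / N] apart, enough for the [N] moved slabs
    to be disjoint. They have equal measure, and the sum is at most [1]. *)
Lemma thin_slab_measure_le j (t : R) (N : nat) : j != i0 -> (0 < N)%N -> (0 < n)%N ->
  20 * n%:R * N%:R ^+ 2 * t <= 1 -> (mu (thin_slab j t) <= (N%:R^-1)%:E)%E.
Proof.
move=> ji N0 n0 small; have [_ inv] := mu_uniform.
have NR0 : 0 < N%:R :> R by rewrite ltr0n.
have nR0 : 0 < n%:R :> R by rewrite ltr0n.
pose reflects (k : nat) (W : 'M[C]_n) := W \is unitarymx /\
  forall x, (1 + (k%:R / N%:R) ^+ 2)%:C * (W *m x) i0 0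
      = (1 - (k%:R / N%:R) ^+ 2)%:C * x i0 0 + (2 * (k%:R / N%:R))%:C * x j 0 /\
    forall i, i != i0 -> i != j -> (W *m x) i 0 = x i 0.
have [U UP] : {U & forall k, reflects k (U k)}.
  apply: (@choice _ _ reflects) => k.
  by have [W uW WE] := plane_reflection (k%:R / N%:R) ji; exists W.
have mB : measurable (thin_slab j t : set (borelC R n)).
  have := measurable_thin_slab 1%:M j t.
  by under eq_set do rewrite mul1mx.
pose F (k : nat) : set (borelC R n) :=
  if (k < N)%N then [set x | thin_slab j t (U k *m (x : 'cV[C]_n))] else set0.
have mF k : measurable (F k).
  by rewrite /F; case: ifP => _; [exact: measurable_thin_slab|exact: measurable0].
have muF k : (k < N)%N -> mu (F k) = mu (thin_slab j t).
  by move=> kN; rewrite /F kN; exact: (inv _ (UP k).1 _ mB).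
have inF k x : F k x -> thin_slab j t (U k *m (x : 'cV[C]_n)) /\ (k < N)%N.
  by rewrite /F; case: (ltnP k N).
have tF : trivIset setT F.
  move=> k l _ _ [x [/inF[xk kN] /inF[xl lN]]].
  apply/eqP; apply: contraT => kl; exfalso.
  have range (h : nat) : (h < N)%N -> 0 <= (h%:R / N%:R : R) <= 1.
    by move=> hN; rewrite divr_ge0//= ler_pdivrMr// mul1r ler_nat ltnW.
  have x1 : l2norm (x : 'cV[C]_n) = 1 by rewrite -(unitary_l2norm x (UP k).1); case: xk.
  have [ek ok] := (UP k).2 x; have [el _] := (UP l).2 x.
  apply: (reflected_slabs_disjoint n0 ji x1 (range _ kN) (range _ lN) _ ek el ok xk xl).
  have dist : 1 <= (k%:R - l%:R : R) ^+ 2.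
    rewrite -real_normK ?num_real// expr_ge1//.
    have [h|h] := orP (etrans (esym (neq_ltn k l)) kl).
      by rewrite distrC ger0_norm -natrB ?ler1n ?subn_gt0// ltnW.
    by rewrite ger0_norm -natrB ?ler1n ?subn_gt0// ltnW.
  rewrite -mulrBl exprMn exprVn ler_pdivlMr ?exprn_gt0// mulrAC.
  exact: le_trans small dist.
have := measure_bigsetU mu mF tF N.
have mu1 : (mu (\big[setU/set0]_(k < N) F k) <= 1)%E.
  by apply: probability_le1; apply: bigsetU_measurable => k _; exact: mF.
have fin : mu (thin_slab j t) \is a fin_num by exact: fin_num_measure.
rewrite (eq_bigr (fun=> (fine (mu (thin_slab j t)))%:E)) => [e|k _]; last first.
  by rewrite fineK//; exact: muF.
move: mu1; rewrite e sumEFin sumr_const card_ord lee_fin => h.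
rewrite -(fineK fin) lee_fin.
by rewrite -div1r ler_pdivlMr// mulr_natr.
Qed.

End AntiConcentration.

(** * A finite union bound *)

Section UnionBound.
Local Open Scope ereal_scope.

Lemma measure_bigU_le d (T : measurableType d) (R : realType)
    (mu : probability T R) (I : Type) (r : seq I) (F : I -> set T) (c : R) :
  (forall i, measurable (F i)) -> (forall i, mu (F i) <= c%:E) ->
  mu (\big[setU/set0]_(i <- r) F i) <= ((size r)%:R * c)%:E.
Proof.
move=> mF Fc; elim: r => [|i r IH]; first by rewrite big_nil measure0 mul0r.
rewrite big_cons; apply: le_trans (measureU2 _ _ _) _ => //.
  exact: bigsetU_measurable.
by rewrite /= -natr1 mulrDl mul1r EFinD addeC leeD.
Qed.

End UnionBound.

(** * Small coordinates of a uniform vector *)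

Section SmallCoordinates.
Variable R : realType.
Local Notation C := R[i].

(** A unitary map turns [dotv u] into the coordinate [i0], up to a phase. Some coordinate has
    squared modulus at least [1 / n]; since [t <= n%:R^-1] it is not [i0], so the slabs with
    [j != i0] cover the set. *)
Lemma measure_small_coord n (mu : probability (borelC R n) R) (i0 : 'I_n)
    (u : 'cV[C]_n) (t : R) (N : nat) :
  uniform_sphere mu -> l2norm u = 1 -> (0 < N)%N ->
  20 * n%:R * N%:R ^+ 2 * t <= 1 -> t <= n%:R^-1 ->
  let B : set (borelC R n) := [set x | l2norm (x : 'cV[C]_n) = 1 /\
    normc (dotv u (x : 'cV[C]_n)) ^+ 2 < t] in
  measurable B /\ (mu B <= (n%:R / N%:R)%:E)%E.
Proof.
move=> hmu u1 N0 tN tn B; have n0 : (0 < n)%N by apply: leq_ltn_trans (ltn_ord i0).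
have [U Uu hU] := unitary_first_row i0 u1.
have nR0 : 0 < n%:R :> R by rewrite ltr0n.
pose D M : set (borelC R n) := [set x | l2norm (M *m (x : 'cV[C]_n)) = 1] `&`
  [set x | normc ((M *m (x : 'cV[C]_n)) i0 0) ^+ 2 < t].
have mD M : measurable (D M).
  by apply: measurableI; [exact: measurable_sphere|exact: measurable_normc_lt].
have BE : B = D U.
  by apply/seteqP; split => x /=; rewrite /D /= unitary_l2norm// hU.
have muB : mu B = mu (D 1%:M).
  rewrite -(hmu.2 U Uu _ (mD _)) BE; congr (mu _).
  by apply/seteqP; split => x /=; rewrite /D /= !mul1mx.
split; first by rewrite BE.
rewrite muB; pose F j : set (borelC R n) := if j == i0 then set0 else thin_slab i0 j t.
have mF j : measurable (F j).
  rewrite /F; case: ifP => _; first exact: measurable0.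
  have := measurable_thin_slab i0 1%:M j t.
  by under eq_set do rewrite mul1mx.
have Fc j : (mu (F j) <= (N%:R^-1)%:E)%E.
  rewrite /F; case: eqVneq => [_|ji]; first by rewrite measure0 lee_fin invr_ge0.
  exact: thin_slab_measure_le.
have := measure_bigU_le (enum 'I_n) mF Fc; rewrite size_enum_ord.
apply: le_trans; apply: le_measure; rewrite ?inE//.
  by apply: bigsetU_measurable.
move=> x; rewrite /D /= mul1mx => -[x1 xt].
have [j ji xj] : exists2 j, j != i0 & n%:R^-1 <= normc (x j 0) ^+ 2.
  apply: contrapT => none.
  have lt j : normc ((x : 'cV[C]_n) j 0) ^+ 2 < n%:R^-1.
    have [->|ji] := eqVneq j i0; first exact: lt_le_trans tn.
    by rewrite ltNge; apply/negP => le; apply: none; exists j.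
  have : l2norm (x : 'cV[C]_n) ^+ 2 < 1.
    rewrite l2norm_sqr; apply: (@lt_le_trans _ _ (\sum_(j < n) n%:R^-1)).
      apply: ltr_sum => [|j _]; last exact: lt.
      by apply/hasP; exists i0 => //; rewrite mem_index_enum.
    by rewrite sumr_const card_ord -[leLHS]mulr_natl divff ?gt_eqF.
  by rewrite x1 expr1n ltxx.
rewrite -bigcup_seq; exists j => /=; first by rewrite mem_enum.
rewrite /F (negbTE ji); split => //.
have : l2norm (x : 'cV[C]_n) ^+ 2 = 1 by rewrite x1 expr1n.
rewrite l2norm_sqr (bigD1 i0)//= (bigD1 j)//=.
by move: xj (sqr_ge0 (normc ((x : 'cV[C]_n) i0 0))); lra.
Qed.

(** The dual row pairs to [1] with the unit column; the squared norm of their difference is then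
    [l2norm w ^+ 2 - 1]. *)
Lemma dual_row_norm_ge1 n (V : 'M[C]_n) j : V \in unitmx -> l2norm (col j V) = 1 ->
  1 <= l2norm ((row j (invmx V))^t* : 'cV[C]_n).
Proof.
move=> uV Vj; set w := _^t*.
have wv : dotv w (col j V) = 1.
  by rewrite /dotv trmxCK -row_mul colE mulmxA mulVmx// mul1mx !mxE !eqxx.
have := sqr_ge0 (l2norm (w + (-1) *: col j V)).
rewrite l2norm_sqrD dotvZr wv mulr1 l2normZ Vj Re_N normcN normc1 mulr1 expr1n /=.
move=> h; rewrite -(@expr_ge1 _ 2) ?l2norm_ge0//; lra.
Qed.

End SmallCoordinates.

(** * Choice of constants for the random vector *)

Section Thresholds.
Variable R : realType.
Implicit Types (q X : R).

Lemma powR_2D_ge X (a : R) : 1 <= X -> 0 < a ->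
  X `^ (2 + a) = X ^+ 2 * X `^ a /\ 1 <= X `^ a.
Proof.
move=> X1 a0; have X0 : 0 < X by lra.
split.
  rewrite powRD; last by apply/implyP => _; rewrite gt_eqF.
  by rewrite powR_mulrn// ltW.
by rewrite -[leLHS](powRr0 X) ler_powR// ltW.
Qed.

Lemma threshold_slab X q : 2 <= X -> X ^+ 2 <= q ->
  20 * X * ((Num.trunc q).+1%:R) ^+ 2 * q ^- 6 <= 1 /\ q ^- 6 <= X^-1.
Proof.
move=> X2 Xq; have q4 : 4 <= q by apply: le_trans Xq; nra.
have q0 : 0 < q by lra.
have X0 : 0 < X by lra.
have qX : 2 * X <= q by apply: le_trans Xq; nra.
have Nq : (Num.trunc q).+1%:R <= 5 / 4 * q.
  rewrite -natr1; have := truncn_itv (ltW q0) => /andP[h _]; lra.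
split; last first.
  rewrite lef_pV2 ?posrE ?exprn_gt0//.
  apply: (@le_trans _ _ q); first by lra.
  by rewrite exprS ler_peMr ?(ltW q0)// exprn_ege1//; lra.
have q6 : 0 < q ^+ 6 by rewrite exprn_gt0.
rewrite ler_pdivrMr// mul1r.
have N2 : ((Num.trunc q).+1%:R : R) ^+ 2 <= (5 / 4 * q) ^+ 2.
  by apply: lerXn2r; rewrite ?nnegrE ?mulr_ge0 ?(ltW q0).
have q3 : 64 <= q ^+ 3.
  have : (4 : R) ^+ 3 <= q ^+ 3 by apply: lerXn2r; rewrite ?nnegrE// ltW.
  by lra.
apply: (@le_trans _ _ (20 * X * (5 / 4 * q) ^+ 2)).
  by rewrite ler_wpM2l// mulr_ge0// ltW.
have -> : q ^+ 6 = q ^+ 3 * q * q ^+ 2 by ring.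
have -> : 20 * X * (5 / 4 * q) ^+ 2 = (125 / 4 * X) * q ^+ 2 by field.
rewrite ler_wpM2r ?sqr_ge0//.
apply: (@le_trans _ _ (64 * q)); first by lra.
by rewrite ler_wpM2r// ltW.
Qed.

Lemma sqr_le_ratio (x y t z : R) : 0 <= x -> x <= y -> 0 < t -> t <= z ->
  x ^+ 2 <= y ^+ 2 / t * z.
Proof.
move=> x0 xy t0 tz; rewrite mulrAC ler_pdivlMr//.
by apply: ler_pM => //; [exact: sqr_ge0|exact: ltW|nra].
Qed.

(** [r ^+ 2 / q ^- 6] is at most [(q * (g * r) ^+ 2) ^+ 6]: the width [q ^- 6] is matched to the
    factor [6] in front of the logarithm. *)
Lemma probabilistic_rhs_ge (g r q M : R) : 1 <= g -> 1 <= r -> 1 <= q -> 1 <= M ->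
  ln (r ^+ 2 / q ^- 6) / M + ((g * r) ^+ 2 - 1)
  <= 6 * (g * r) ^+ 2 / M * ln (q * (g * r) ^+ 2) + 4 * (g * r) * (g * r - 1) /\
  0 <= 6 * (g * r) ^+ 2 / M * ln (q * (g * r) ^+ 2) + 4 * (g * r) * (g * r - 1).
Proof.
move=> g1 r1 q1 M1; set k := g * r.
have rk : r <= k by rewrite /k; nra.
have k1 : 1 <= k by lra.
have M0 : 0 < M by lra.
have k2 : 1 <= k ^+ 2 by nra.
have qk1 : 1 <= q * k ^+ 2 by nra.
have lnge : 0 <= ln (q * k ^+ 2) by rewrite ln_ge0.
have ls : ln (r ^+ 2 / q ^- 6) <= 6 * ln (q * k ^+ 2).
  have P1 : 0 < q * k ^+ 2 by lra.
  have P2 : 0 < q ^+ 6 * r ^+ 2 by rewrite mulr_gt0 ?exprn_gt0//; lra.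
  have P3 : 0 < (q * k ^+ 2) ^+ 6 by rewrite exprn_gt0.
  rewrite invrK mulrC [leRHS]mulrC mulr_natr -lnXn// ler_ln ?posrE//.
  have Q6 : 0 <= q ^+ 6 by rewrite exprn_ge0//; lra.
  rewrite exprMn ler_wpM2l//.
  apply: (@le_trans _ _ (k ^+ 2)); first by apply: lerXn2r; rewrite ?nnegrE//; lra.
  by rewrite [leRHS]exprS ler_peMr ?exprn_ege1// ?sqr_ge0.
have h : ln (r ^+ 2 / q ^- 6) / M <= 6 * k ^+ 2 / M * ln (q * k ^+ 2).
  rewrite [leRHS]mulrAC ler_pM2r ?invr_gt0//; apply: le_trans ls _.
  by rewrite -mulrA ler_wpM2l// ler_peMl.
have h0 : 0 <= 6 * k ^+ 2 / M * ln (q * k ^+ 2).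
  apply: mulr_ge0 => //; apply: divr_ge0; last exact: ltW.
  by apply: mulr_ge0 => //; exact: sqr_ge0.
by split; nra.
Qed.

End Thresholds.

Theorem theorem4p4 (R : realType) (m n : nat) (hm : (0 < m)%N) (hn : (0 < n)%N)
    (A V : 'M[R[i]]_n) (L : 'rV[R[i]]_n)
    (hV : V \in unitmx) (hA : A = V *m diag_mx L *m invmx V)
    (hVcol : forall j : 'I_n, l2norm (col j V) = 1)
    (Q : forall b : 'cV[R[i]]_n, 'M[R[i]]_(n, \dim (krylov A b (6 * m + 1))))
    (hQ : forall b : 'cV[R[i]]_n, b != 0 ->
        orthonormal_basis (krylov A b (6 * m + 1)) (Q b)) :
  (forall b : 'cV[R[i]]_n, b != 0 ->
    0 < min_sqr (invmx V *m b) ->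
    (hausdorff (numrange (compression A (Q b))) (numrange A)
     <= (Num.max 0
           (6 * cond V ^+ 2 / m%:R
              * ln (expR 1 * m%:R * l2norm (invmx V *m b) ^+ 2
                      / (6 * min_sqr (invmx V *m b)))
            + 4 * cond V * (cond V - 1)))%:E
        * diam (convex_hull (spectrum A)))%E)
  /\
  (forall (d : measure_display) (T : measurableType d) (P : probability T R)
      (b : {mfun T >-> borelC R n}),
    uniform_sphere (distribution P b) ->
    forall a : R, 0 < a ->
    ((1 - 5 * m%:R / (4 * n%:R `^ a))%:E
     <= P [set w | (hausdorff (numrange (compression A (Q (b w)))) (numrange A)
             <= (6 * cond V ^+ 2 / m%:R
                   * ln (n%:R `^ (2 + a) * cond V ^+ 2)
                 + 4 * cond V * (cond V - 1))%:E
                * diam (convex_hull (spectrum A)))%E])%E).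
Proof.
have AV : A *m V = V *m diag_mx L by rewrite hA mulmxKV.
have [D LD Ddiam] := diam_spectrum_ge hn hV AV.
have m1 : 1 <= m%:R :> R by rewrite ler1n.
have k1 : 1 <= cond V := cond_ge1 hV (hVcol (Ordinal hn)).
split=> [b b0 ap|d T P b unif a a0].
  set c := invmx V *m b in ap *.
  have c_gt j : 0 < normc (c j 0) ^+ 2 := lt_le_trans ap (min_sqr_le c j).
  (* Nonnegativity of [e] lets the bound pass from [D] to the diameter. *)
  set e := Num.max _ _; have e0 : 0 <= e by rewrite /e le_max lexx.
  apply: (@le_trans _ _ (e * D)%:E); last by rewrite EFinM lee_wpmul2l// lee_fin.
  apply: (hausdorff_krylov_le hm hn hV AV (@hQ b) LD (s := l2norm c ^+ 2 / min_sqr c)) => //.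
  - by move=> j; apply: contraTneq (c_gt j) => ->; rewrite normc0 expr0n ltxx.
  - move=> j; rewrite mulrAC ler_pdivlMr// ler_wpM2l ?sqr_ge0//.
    exact: min_sqr_le.
  move=> n3; rewrite /e le_max; apply/orP; right.
  have -> : expR 1 * m%:R * l2norm c ^+ 2 / (6 * min_sqr c)
      = expR 1 * m%:R * (l2norm c ^+ 2 / min_sqr c) / 6.
    by field; rewrite gt_eqF.
  apply: deterministic_rhs_ge => //.
  (* Each of the at least three coordinates contributes [min_sqr c] or more. *)
  rewrite ler_pdivlMr// l2norm_sqr.
  apply: (@le_trans _ _ (\sum_(j < n) min_sqr c)).
    by rewrite sumr_const card_ord -[leRHS]mulr_natl ler_wpM2r ?(ltW ap)// ler_nat.
  by apply: ler_sum => j _; exact: min_sqr_le.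
set e := _ + _ * (_ - _).
pose mu : probability (borelC R n) R := distribution P b.
pose Ev : set (borelC R n) :=
  [set x | (hausdorff (numrange (compression A (Q x))) (numrange A)
    <= e%:E * diam (convex_hull (spectrum A)))%E].
have mEv : measurable Ev by exact: (measurable_hausdorff_le hn hV AV hQ).
rewrite -[P _]/(mu Ev).
(* For [n = 1] the claimed lower bound is [1 - 5 * m / 4], which is negative. *)
have [n2|n2] := ltnP n 2.
  have n1 : n = 1%N by apply/eqP; rewrite eqn_leq -ltnS n2.
  apply: (@le_trans _ _ 0%E); last exact: measure_ge0.
  rewrite lee_fin [X in X%:R `^ _]n1 powR1 mulr1; lra.
pose X : R := n%:R.
have X2 : 2 <= X by rewrite ler_nat.
have [qE Xa1] := powR_2D_ge (le_trans (ler1n _ 2) X2) a0.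
pose q := X `^ (2 + a).
have Xq : X ^+ 2 <= q by rewrite /q qE ler_peMr ?sqr_ge0.
have q4 : 4 <= q by apply: le_trans Xq; nra.
have q0 : 0 < q by lra.
pose t := q ^- 6; pose N := (Num.trunc q).+1.
have t0 : 0 < t by rewrite invr_gt0 exprn_gt0.
have [tN tX] := threshold_slab X2 Xq.
(* Entry [j] of [invmx V *m x] is [dotv (w j) x]. As [w j] has norm at least one, normalizing it to
   [u j] can only decrease the modulus. *)
pose w j : 'cV[R[i]]_n := (row j (invmx V))^t*.
have w1 j : 1 <= l2norm (w j) := dual_row_norm_ge1 hV (hVcol j).
pose u j := (l2norm (w j))^-1%:C *: w j.
have u1 j : l2norm (u j) = 1.
  have W0 : 0 < l2norm (w j) := lt_le_trans ltr01 (w1 j).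
  by rewrite l2normZ normc_real ger0_norm ?invr_ge0 ?(ltW W0)// mulVf ?gt_eqF.
have ux j (x : 'cV[R[i]]_n) : normc (dotv (u j) x) <= normc ((invmx V *m x) j 0).
  have -> : (invmx V *m x) j 0 = dotv (w j) x.
    by rewrite /dotv /w trmxCK -row_mul [RHS]mxE.
  rewrite dotvZl normcM normcJ normc_real ler_piMl ?normc_ge0//.
  by rewrite ger0_norm ?invr_ge0 ?l2norm_ge0// invf_le1// (lt_le_trans ltr01).
pose Bad j : set (borelC R n) := [set x | l2norm (x : 'cV[R[i]]_n) = 1 /\
  normc (dotv (u j) (x : 'cV[R[i]]_n)) ^+ 2 < t].
have badP j := measure_small_coord (Ordinal hn) unif (u1 j) (ltn0Sn _ : (0 < N)%N) tN tX.
have mBad j : measurable (Bad j) := (badP j).1.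
have muBad := measure_bigU_le (enum 'I_n) mBad (fun j => (badP j).2).
rewrite size_enum_ord in muBad.
pose S : set (borelC R n) := [set x | l2norm (x : 'cV[R[i]]_n) = 1].
have mS : measurable S.
  have := @measurable_sphere R n 1%:M.
  by under eq_set do rewrite mul1mx.
have mU : measurable (\big[setU/set0]_(j <- enum 'I_n) Bad j).
  exact: bigsetU_measurable.
(* On the sphere [l2norm c <= spectral_norm (invmx V)], and off the bad sets every
   [normc (c j 0) ^+ 2] is at least [t], whence [s = r ^+ 2 / t]. *)
have cover : S `<=` Ev `|` \big[setU/set0]_(j <- enum 'I_n) Bad j.
  move=> x x1; have [bad|good] := pselect (exists j, Bad j x).
    right; rewrite -bigcup_seq; have [j xj] := bad.
    by exists j; rewrite //= mem_enum.
  left; rewrite /Ev /=; set c := invmx V *m (x : 'cV[R[i]]_n).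
  have ct j : t <= normc (c j 0) ^+ 2.
    have h : t <= normc (dotv (u j) (x : 'cV[R[i]]_n)) ^+ 2.
      by rewrite leNgt; apply/negP => h; apply: good; exists j.
    by apply: le_trans h _; apply: lerXn2r; rewrite ?nnegrE ?normc_ge0.
  set r := spectral_norm (invmx V); set g := spectral_norm V.
  have r1 : 1 <= r := spectral_norm_inv_ge1 hV (hVcol (Ordinal hn)).
  have g1 : 1 <= g by rewrite -(hVcol (Ordinal hn)) spectral_norm_ge_col.
  have q1 : 1 <= q by lra.
  have [eb e0] := probabilistic_rhs_ge g1 r1 q1 m1.
  apply: (@le_trans _ _ (e * D)%:E); last by rewrite EFinM lee_wpmul2l// lee_fin.
  apply: (hausdorff_krylov_le hm hn hV AV (@hQ x) LD (s := r ^+ 2 / t)) => //.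
    by move=> j; apply: contraTneq (lt_le_trans t0 (ct j)) => ->; rewrite normc0 expr0n ltxx.
  move=> j; apply: sqr_le_ratio (l2norm_ge0 _) _ t0 (ct j).
  by have := l2norm_mulmx_le (invmx V) x; rewrite (x1 : l2norm _ = 1) mulr1.
have S1 : mu S = 1%E by exact: unif.1.
have : (1%:E <= mu Ev + (n%:R * (n%:R / N%:R))%:E)%E.
  rewrite -S1; apply: (@le_trans _ _ (mu (Ev `|` \big[setU/set0]_(j <- enum 'I_n) Bad j))).
    by apply: le_measure; rewrite ?inE//; exact: measurableU.
  apply: le_trans (measureU2 _ _ _) _ => //.
  by rewrite leeD2l.
have finE : mu Ev \is a fin_num by exact: fin_num_measure.
rewrite -(fineK finE) -EFinD !lee_fin => h.
have qN : q <= N%:R by rewrite ltW// truncnS_gt.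
(* The [n] bad sets, of measure at most [n / N] each, cost at most [X ^+ 2 / q], which is n to the
   power -a; and [1 <= 5 * m / 4]. *)
have : n%:R * (n%:R / N%:R) <= 5 * m%:R / (4 * n%:R `^ a) :> R.
  apply: (@le_trans _ _ (X ^+ 2 / q)).
    rewrite mulrA -expr2; apply: ler_wpM2l; first exact: sqr_ge0.
    by rewrite lef_pV2 ?posrE// ltr0n.
  have X0 : 0 < X by lra.
  have -> : X ^+ 2 / q = (X `^ a)^-1.
    rewrite /q qE invfM mulrA divff ?mul1r//.
    by rewrite gt_eqF// exprn_gt0.
  rewrite invfM mulrA -[leLHS]mul1r ler_wpM2r ?invr_ge0 ?powR_ge0//.
  by lra.
by lra.
Qed.
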